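(* Let $(\bar{\mathbf x},\bar R)\in\mathbb{R}^3\times SO(3)$ and an initial shape $(\bar\vartheta,\bar\varphi)\in\mathbb{R}\times\mathbb{T}$ be given. For any controls $u_1,u_2\in L^\infty(0,+\infty)$ there exists a unique absolutely continuous solution $t\mapsto(\mathbf x_t,R_t)\colon[0,+\infty)\to\mathbb{R}^3\times SO(3)$ to the Cauchy problem for the equations of motion of the $2$-link swimmer $$R_t^{-1}\dot{\mathbf x}_t \text{ and } R_t^{-1}\boldsymbol\omega_t \text{ given by } \begin{pmatrix}R_t^{-1}\dot{\mathbf x}_t\\ R_t^{-1}\boldsymbol\omega_t\end{pmatrix}=v_1(\vartheta_t,\varphi_t)u_1(t)+v_2(\vartheta_t,\varphi_t)u_2(t),\qquad \dot\varphi_t=u_1(t),\quad \dot\vartheta_t=u_2(t)\qquad(\text{a.e. }t),$$ with initial condition $(\mathbf x_0,R_0)=(\bar{\mathbf x},\bar R)$ and initial shape $(\vartheta_0,\varphi_0)=(\bar\vartheta,\bar\varphi)$.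
   Context: The $2$-link swimmer. Fix constants $L>0$ (common length of the two links), $0<C_\parallel<C_\perp$ (parallel and perpendicular drag coefficients) and $C_\tau>0$ (torsional drag coefficient of link 1). Let $\mathbb{T}=\mathbb{R}/2\pi\mathbb{Z}$. The shape is $s=(\vartheta,\varphi)\in\mathbb{R}\times\mathbb{T}$. Put $\tilde e^{(1)}=(0,0,1)^\top$ and $\tilde e^{(2)}=(\sin\varphi\cos\vartheta,\sin\varphi\sin\vartheta,\cos\varphi)^\top$ (directions of the links in the co-moving frame), and let $\tilde E^{(i)}$ be the $3\times3$ matrix with $\tilde E^{(i)}v=\tilde e^{(i)}\times v$. With $(a\otimes b)_{ij}=a_ib_j$, define $$\tilde K=L\sum_{i=1}^2\big[(C_\parallel-C_\perp)\tilde e^{(i)}\otimes\tilde e^{(i)}+C_\perp I\big],\qquad \tilde C=\tfrac{L^2}{2}C_\perp\big(\tilde E^{(1)}+\tilde E^{(2)}\big),$$ $$\tilde J=\tfrac{L^3}{3}C_\perp\sum_{i=1}^2\big[I-\tilde e^{(i)}\otimes\tilde e^{(i)}\big]+LC_\tau\,\tilde e^{(1)}\otimes\tilde e^{(1)},\qquad \tilde{\mathcal M}=\begin{pmatrix}\tilde K&\tilde C^\top\\ \tilde C&\tilde J\end{pmatrix}.$$ The $6\times6$ matrix $\tilde{\mathcal M}=\tilde{\mathcal M}(\vartheta,\varphi)$ (grand resistance matrix) is symmetric and positive definite. Define $v_1,v_2\colon\mathbb{R}\times\mathbb{T}\to\mathbb{R}^6$ by $$v_1=\tilde{\mathcal M}^{-1}\Big(-\tfrac{L^2}{2}C_\perp\cos\vartheta\cos\varphi,\,-\tfrac{L^2}{2}C_\perp\sin\vartheta\cos\varphi,\,\tfrac{L^2}{2}C_\perp\sin\varphi,\,\tfrac{L^3}{3}C_\perp\sin\vartheta,\,-\tfrac{L^3}{3}C_\perp\cos\vartheta,\,0\Big)^\top,$$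 $$v_2=\tilde{\mathcal M}^{-1}\Big(\tfrac{L^2}{2}C_\perp\sin\vartheta\sin\varphi,\,-\tfrac{L^2}{2}C_\perp\cos\vartheta\sin\varphi,\,0,\,\tfrac{L^3}{6}C_\perp\cos\vartheta\sin2\varphi,\,\tfrac{L^3}{6}C_\perp\sin\vartheta\sin2\varphi,\,-\tfrac{L^3}{3}C_\perp\sin^2\varphi\Big)^\top.$$ Here $\mathbf x_t\in\mathbb{R}^3$ is the position of the hinge, $R_t\in SO(3)$ the orientation of the co-moving frame, and $\boldsymbol\omega_t$ the angular velocity of $R_t$, i.e. $\dot R_tR_t^{-1}v=\boldsymbol\omega_t\times v$ for all $v\in\mathbb{R}^3$. *)

(* Defs.v *)
From HB Require Import structures.
From mathcomp Require Import all_boot all_order all_algebra.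
From mathcomp Require Import all_classical all_reals all_analysis.

Set Implicit Arguments.
Unset Strict Implicit.
Unset Printing Implicit Defensive.

Import Order.TTheory GRing.Theory Num.Theory.
Import numFieldNormedType.Exports.

Local Open Scope classical_set_scope.
Local Open Scope ring_scope.
Local Open Scope quotient_scope.

Section Vectors.
Context {R : realType}.

Definition vec3 (a b c : R) : 'cV[R]_3 := \col_(i < 3) [:: a; b; c]`_i.

Definition cross (a b : 'cV[R]_3) : 'cV[R]_3 :=
  vec3 (a 1 0 * b 2 0 - a 2 0 * b 1 0)
       (a 2 0 * b 0 0 - a 0 0 * b 2 0)
       (a 0 0 * b 1 0 - a 1 0 * b 0 0).

(* The matrix of [cross a], given columnwise; see [skewE]. *)
Definition skew (a : 'cV[R]_3) : 'M[R]_3 :=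
  \matrix_(i, j) cross a (delta_mx j 0) i 0.

Lemma skewE (a v : 'cV[R]_3) : skew a *m v = cross a v.
Proof.
apply/matrixP => i j; rewrite ord1 {j} !mxE.
under eq_bigr do rewrite !mxE.
rewrite !big_ord_recl big_ord0.
have -> : lift ord0 (lift ord0 ord0) = 2 :> 'I_3 by apply/val_inj.
have -> : lift ord0 ord0 = 1 :> 'I_3 by apply/val_inj.
have -> : ord0 = 0 :> 'I_3 by apply/val_inj.
by case: i => [[|[|[|i]]] ilt] //=;
  rewrite ?(eqxx, mulr1, mulr0, subr0, sub0r, addr0, add0r, mulr1n, mulr0n) /=
    ?oppr0 ?mul0r ?add0r ?addr0 ?mulNr //; rewrite addrC.
Qed.

Definition tens (a b : 'cV[R]_3) : 'M[R]_3 := a *m b^T.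

Definition is_rotation (Q : 'M[R]_3) : Prop :=
  Q^T *m Q = 1%:M /\ \det Q = 1.

End Vectors.

Section Torus.
Context {R : realType}.

Definition eqmod2pi : rel R := fun x y => (x - y) / (pi *+ 2) \is a Num.int.

Lemma eqmod2pi_refl : reflexive eqmod2pi.
Proof. by move=> x; rewrite /eqmod2pi subrr mul0r rpred0. Qed.

Lemma eqmod2pi_sym : symmetric eqmod2pi.
Proof. by move=> x y; rewrite /eqmod2pi -opprB mulNr rpredN. Qed.

Lemma eqmod2pi_trans : transitive eqmod2pi.
Proof.
move=> y x z xy yz; rewrite /eqmod2pi -(subrK y x) -addrA mulrDl.
exact: rpredD.
Qed.

Canonical eqmod2pi_equiv :=
  EquivRel eqmod2pi eqmod2pi_refl eqmod2pi_sym eqmod2pi_trans.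

Definition torus : Type := {eq_quot eqmod2pi_equiv}.

Definition to_torus (x : R) : torus := \pi_{eq_quot eqmod2pi_equiv} x.

(* Meant for 2 pi-periodic [f] only; see [of_torusE]. *)
Definition of_torus {A : Type} (f : R -> A) (p : torus) : A :=
  f (repr (p : {eq_quot eqmod2pi_equiv})).

Lemma to_torus_eq (x y : R) :
  to_torus x = to_torus y <-> exists k : int, x = y + (pi *+ 2) *~ k.
Proof.
have p0 : pi *+ 2 != 0 :> R by rewrite mulrn_eq0 /= gt_eqF ?pi_gt0.
split=> [/eqmodP/=|[k ->]].
- move=> /intrP[k kE]; exists k.
  by rewrite -mulrzl -kE divfK// addrC subrK.
- by apply/eqmodP; rewrite /= /eqmod2pi addrC addKr -mulrzl mulfK// intr_int.
Qed.

Lemma of_torusE {A : zmodType} (f : R -> A) (x : R) :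
  periodic f (pi *+ 2) -> of_torus f (to_torus x) = f x.
Proof.
move=> fp; rewrite /of_torus.
have /to_torus_eq[k ->] : to_torus (repr (to_torus x)) = to_torus x.
  exact: reprK.
have fn (n : nat) a : f (a + (pi *+ 2) *+ n) = f a.
  by elim: n a => [|n IH] a; rewrite ?mulr0n ?addr0// mulrSr addrA fp.
case: k => n; first exact: fn.
by rewrite NegzE mulrNz -(fn n.+1) subrK.
Qed.

End Torus.
Arguments torus : clear implicits.

Section Swimmer.
Context {R : realType}.
Variables (L Cpar Cperp Ctau : R).
Implicit Types th ph : R.

Definition link1 : 'cV[R]_3 := vec3 0 0 1.

Definition link2 th ph : 'cV[R]_3 :=
  vec3 (sin ph * cos th) (sin ph * sin th) (cos ph).

Definition links th ph : seq 'cV[R]_3 := [:: link1; link2 th ph].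

Definition resK th ph : 'M[R]_3 :=
  L *: \sum_(e <- links th ph) ((Cpar - Cperp) *: tens e e + Cperp *: 1%:M).

Definition resC th ph : 'M[R]_3 :=
  (L ^+ 2 / 2 * Cperp) *: \sum_(e <- links th ph) skew e.

Definition resJ th ph : 'M[R]_3 :=
  (L ^+ 3 / 3 * Cperp) *: \sum_(e <- links th ph) (1%:M - tens e e)
  + (L * Ctau) *: tens link1 link1.

Definition grand_resistance th ph : 'M[R]_(3 + 3) :=
  block_mx (resK th ph) (resC th ph)^T (resC th ph) (resJ th ph).

Definition v1 th ph : 'cV[R]_(3 + 3) :=
  invmx (grand_resistance th ph) *m
  col_mx (vec3 (- (L ^+ 2 / 2 * Cperp * cos th * cos ph))
               (- (L ^+ 2 / 2 * Cperp * sin th * cos ph))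
               (L ^+ 2 / 2 * Cperp * sin ph))
         (vec3 (L ^+ 3 / 3 * Cperp * sin th)
               (- (L ^+ 3 / 3 * Cperp * cos th))
               0).

Definition v2 th ph : 'cV[R]_(3 + 3) :=
  invmx (grand_resistance th ph) *m
  col_mx (vec3 (L ^+ 2 / 2 * Cperp * sin th * sin ph)
               (- (L ^+ 2 / 2 * Cperp * cos th * sin ph))
               0)
         (vec3 (L ^+ 3 / 6 * Cperp * cos th * sin (2 * ph))
               (L ^+ 3 / 6 * Cperp * sin th * sin (2 * ph))
               (- (L ^+ 3 / 3 * Cperp * sin ph ^+ 2))).

Lemma link2_periodic th : periodic (link2 th) (pi *+ 2).
Proof. by move=> ph; rewrite /link2 sinD2pi cosD2pi. Qed.

Lemma grand_resistance_periodic th :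
  periodic (grand_resistance th) (pi *+ 2).
Proof.
by move=> ph; rewrite /grand_resistance /resK /resC /resJ /links link2_periodic.
Qed.

Lemma v1_periodic th : periodic (v1 th) (pi *+ 2).
Proof.
by move=> ph; rewrite /v1 grand_resistance_periodic sinD2pi cosD2pi.
Qed.

Lemma v2_periodic th : periodic (v2 th) (pi *+ 2).
Proof.
move=> ph; rewrite /v2 grand_resistance_periodic sinD2pi mulrDr.
by rewrite [2 * (pi *+ 2)]mulr_natl (periodicn (@sinD2pi R)).
Qed.

End Swimmer.

Section AbsoluteContinuity.
Context {R : realType} {V : normedModType R}.

Definition abs_cont (a b : R) (f : R -> V) : Prop :=
  forall e : R, 0 < e -> exists2 d : R, 0 < d &
    forall (n : nat) (p q : 'I_n -> R),
      (forall i, a <= p i /\ p i <= q i /\ q i <= b) ->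
      trivIset setT (fun i => `]p i, q i[%classic) ->
      \sum_i (q i - p i) < d -> \sum_i `|f (q i) - f (p i)| < e.

(* Absolute continuity on the unbounded interval [0, +oo[ is understood, as for
   Caratheodory solutions, on each compact subinterval: with merely bounded
   controls, derivatives need not be integrable on [0, +oo[. *)
Definition abs_cont0y (f : R -> V) : Prop :=
  forall T : R, 0 <= T -> abs_cont 0 T f.

End AbsoluteContinuity.

(* A control is a function on R of which only the values on ]0, +oo[ matter. *)
Definition Linfty0y {R : realType} (u : R -> R) : Prop :=
  (u \_ `]0, +oo[ : R -> R) \in Lfun (@lebesgue_measure R) +oo%E.

(* [ph] is a curve in R / 2 pi Z with real lift [psi]; absolute continuity and
   the derivative of [ph] are those of [psi]. *)
Definition torus_lift {R : realType} (ph : R -> torus R) (psi : R -> R) : Prop :=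
  forall t, 0 <= t -> ph t = to_torus (psi t).

(* Trajectories are functions on R of which only the values on [0, +oo[ matter. *)
Definition swimmer_solution {R : realType} (L Cpar Cperp Ctau : R)
    (u1 u2 : R -> R) (x : R -> 'cV[R]_3) (Q : R -> 'M[R]_3)
    (th : R -> R) (ph : R -> torus R) : Prop :=
  [/\ abs_cont0y x, abs_cont0y Q, abs_cont0y th,
      forall t, 0 <= t -> is_rotation (Q t) &
      exists psi : R -> R,
      [/\ torus_lift ph psi, abs_cont0y psi &
        {ae lebesgue_measure, forall t : R, 0 < t ->
          [/\ is_derive t 1 psi (u1 t), is_derive t 1 th (u2 t),
              derivable x t 1, derivable Q t 1 &
              exists w : 'cV[R]_3,
                (forall v, derive1 Q t *m invmx (Q t) *m v = cross w v) /\
                col_mx (invmx (Q t) *m derive1 x t) (invmx (Q t) *m w) =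
                  u1 t *: of_torus (v1 L Cpar Cperp Ctau (th t)) (ph t) +
                  u2 t *: of_torus (v2 L Cpar Cperp Ctau (th t)) (ph t)]}]].

(* The unknown is the pair (x, Q) only: the shape curve is determined by the
   controls and its initial value. *)
Definition cauchy_solution {R : realType} (L Cpar Cperp Ctau : R)
    (u1 u2 : R -> R) (x0 : 'cV[R]_3) (Q0 : 'M[R]_3) (th0 : R) (ph0 : torus R)
    (x : R -> 'cV[R]_3) (Q : R -> 'M[R]_3) : Prop :=
  (x 0 = x0 /\ Q 0 = Q0) /\
  exists (th : R -> R) (ph : R -> torus R),
    (th 0 = th0 /\ ph 0 = ph0) /\
    swimmer_solution L Cpar Cperp Ctau u1 u2 x Q th ph.

(* Main.v *)
Require Import Defs.
From mathcomp Require Import all_boot all_order all_algebra.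
From mathcomp Require Import all_classical all_reals all_analysis.
From mathcomp Require Import measurable_realfun ess_sup_inf.
From mathcomp Require Import ring lra.
Import Order.TTheory GRing.Theory Num.Theory.
Import numFieldNormedType.Exports.
Local Open Scope classical_set_scope.
Local Open Scope ring_scope.

(** The shape is the primitive of the controls, so along it the equations read
    [Q' = Q skew(b(t))] and [x' = Q a(t)] with [a], [b] measurable and locally
    bounded: the grand resistance matrix is positive definite, because it is the
    matrix of the dissipated power, hence [v1], [v2] are continuous in the shape.
    Existence is Picard iteration for this linear system.  If [P] and [Q] both
    solve [Q' = Q skew(b)], then [P Q^T] is absolutely continuous with zero
    derivative a.e., hence constant; for [P = Q] this keeps [Q] orthogonal, and
    for two solutions with the same initial value it gives uniqueness. *)

(** The equations hold only almost everywhere, and a continuous function whose derivative vanishes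
    almost everywhere need not be constant (Cantor's function); constancy therefore has to be drawn
    from the epsilon-delta form of absolute continuity. The coefficients [a] and [b] depend on the
    shape and the controls but not on the pair sought. So the system is linear, its solution exists
    for all times, and [x] is a plain integral once [Q] is known. The controls are only essentially
    bounded. Truncations that agree with them almost everywhere are bounded at every point, which
    lets the iteration work with pointwise estimates. Two points need separate care. Orthogonality
    leaves the determinant equal to 1 or -1, and continuity fixes the sign. A solution also hides
    its shape curve and a real lift of the angle, so the shapes of two solutions must be identified
    before their twists can be compared, although the lifts may differ by a multiple of 2 pi. *)

Lemma interval_induction (R : realType) (a b : R) (G : R -> Prop) :
  a <= b -> G a ->
  (forall c, a <= c <= b -> exists2 r : R, 0 < r & forall s t,
     a <= s <= c -> c <= t <= b -> c - r < s -> t < c + r -> G s -> G t) ->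
  G b.
Proof.
move=> ab Ga step.
pose S := [set t | a <= t <= b /\ G t].
have Sa : S a by split=> //; rewrite lexx ab.
have ubS : has_ubound S by exists b => t [/andP[]].
have supS : has_sup S by split=> //; exists a.
pose c := sup S.
have cab : a <= c <= b.
  by rewrite ub_le_sup//= ge_sup//; [exists a|move=> t [/andP[]]].
have [r r0 Gr] := step c cab.
(* From a point [s] of [S] closer than [r] to the supremum [c], the local step carries [G] beyond
   [c]; this is absurd unless [c] is already [b]. *)
have [s [sab Gs] cs] := sup_adherent r0 supS.
have sc : s <= c by apply: ub_le_sup.
have asc : a <= s <= c by rewrite sc andbT; case/andP: sab.
have /andP[ac cb] := cab.
have [cb'|] := ltP c b; last first.
  move=> bc; apply: (Gr s b) => //; last by apply: le_lt_trans bc _; rewrite ltrDl.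
  by rewrite lexx andbT.
pose t := Num.min b (c + r / 2).
have ct : c < t by rewrite lt_min cb' ltrDl divr_gt0.
have tb : t <= b by rewrite ge_min lexx.
have : t <= c.
  apply: ub_le_sup => //; split; first by rewrite tb andbT (le_trans ac)// ltW.
  apply: (Gr s t) => //; first by rewrite tb ltW.
  by rewrite gt_min; apply/orP; right; rewrite ltrD2l ltr_pdivrMr// ltr_pMr// ltr1n.
by rewrite leNgt ct.
Qed.

(** * Absolutely continuous functions with zero derivative almost everywhere *)

Section abs_cont_constant.
Context {R : realType} {V : normedModType R}.
Local Notation mu := (@lebesgue_measure R).

(** The invariant of the continuous induction: the increment of [f] up to [t] splits into a part of
    slope [e] and a part carried by finitely many disjoint intervals. Their total length is compared
    with the measure of [U] to the left of [t], so that it stays below any bound on the measure of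
    [U]. *)
Let family_bound (f : R -> V) (a e : R) (U : set R) (t : R) : Prop :=
  exists (n : nat) (p q : 'I_n -> R),
    [/\ forall i, a <= p i /\ p i <= q i /\ q i <= t,
        trivIset setT (fun i => `]p i, q i[%classic),
        ((\sum_i (q i - p i))%:E <= mu (U `&` `]a, t]))%E &
        `|f t - f a| <= e * (t - a) + \sum_i `|f (q i) - f (p i)| ].

Let family_boundW (f : R -> V) a e U s t : open U ->
  family_bound f a e U s -> a <= s -> s <= t ->
  `|f t - f s| <= e * (t - s) -> family_bound f a e U t.
Proof.
move=> oU [n [p [q [pq pqI pqU fs]]]] as_ st fst.
have mU : measurable U by exact: open_measurable.
exists n, p, q; split => //.
- by move=> i; have [? [? ?]] := pq i; split => //; split => //; exact: le_trans st.
- apply: (le_trans pqU); apply: le_measure; rewrite ?inE//.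
  + exact: measurableI.
  + exact: measurableI.
  + apply: setIS => x /=; rewrite !in_itv/= => /andP[->]/=.
    by move=> /le_trans; apply.
- rewrite -(subrKA (f s)) (le_trans (ler_normD _ _))// (le_trans (lerD fst fs))//.
  by rewrite addrA -mulrDr addrA subrK.
Qed.

(** Inside [U] no derivative is available, so []s, t[] joins the family as a new interval. The
    length budget pays for it: [U] gains all of []s, t]], which is disjoint from what was counted up
    to [s]. *)
Let family_boundS (f : R -> V) a e U s t : open U -> 0 <= e ->
  family_bound f a e U s -> a <= s -> s <= t -> `[s, t] `<=` U ->
  family_bound f a e U t.
Proof.
move=> oU e0 [n [p [q [pq pqI pqU fs]]]] as_ st stU.
have mU : measurable U by exact: open_measurable.
pose ext (x : R) (g : 'I_n -> R) (i : 'I_n.+1) :=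
  if unlift ord0 i is Some j then g j else x.
have ext0 x g : ext x g ord0 = x by rewrite /ext unlift_none.
have extS x g j : ext x g (lift ord0 j) = g j by rewrite /ext liftK.
exists n.+1, (ext s p), (ext t q); split.
- move=> i; case: (unliftP ord0 i) => [j ->|->]; rewrite ?ext0 ?extS//.
  by have [? [? ?]] := pq j; split => //; split => //; exact: le_trans st.
- move=> i j _ _.
  case: (unliftP ord0 i) => [i' ->|->]; case: (unliftP ord0 j) => [j' ->|->];
    rewrite ?ext0 ?extS// => -[x [/=]]; rewrite !in_itv/=.
  + move=> xi xj; congr (lift _ _); apply: pqI => //.
    by exists x; split; rewrite /= in_itv.
  + move=> /andP[_ xq] /andP[sx _]; have [_ [_ qs]] := pq i'.
    by move: (lt_trans sx (lt_le_trans xq qs)); rewrite ltxx.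
  + move=> /andP[sx _] /andP[_ xq]; have [_ [_ qs]] := pq j'.
    by move: (lt_trans sx (lt_le_trans xq qs)); rewrite ltxx.
- rewrite big_ord_recl !ext0; under eq_bigr do rewrite !extS.
  apply: (@le_trans _ _ (mu (`]s, t] `|` (U `&` `]a, s]))%E)).
    rewrite measureU//=; last 2 first.
    + exact: measurableI.
    + apply/seteqP; split => // x [/=]; rewrite !in_itv/= => /andP[sx _] [_ /andP[_ xs]].
      by move: (lt_le_trans sx xs); rewrite ltxx.
    rewrite EFinD leeD// lebesgue_measure_itv/= lte_fin.
    by case: ltP => // ts; rewrite lee_fin subr_le0.
  apply: le_measure; rewrite ?inE//.
  + by apply: measurableU => //; exact: measurableI.
  + exact: measurableI.
  + move=> x /= [|[Ux]]; rewrite !in_itv/= => /andP[].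
      move=> sx xt; split; first by apply: stU; rewrite /= in_itv/= xt ltW.
      by rewrite xt (le_lt_trans as_ sx).
    by move=> -> /le_trans ->.
- rewrite big_ord_recl !ext0; under eq_bigr do rewrite !extS.
  rewrite -(subrKA (f s)) (le_trans (ler_normD _ _))// addrCA lerD2l.
  by rewrite (le_trans fs)// lerD2r ler_wpM2l// lerD2r.
Qed.

(* Continuous induction on [a, b]: near a point where the derivative vanishes
   the increment of [f] is at most [e] times the length; the other points are
   covered by an open set of small measure, on which absolute continuity
   controls the total increment. *)
Lemma abs_cont_constant (f : R -> V) (a b : R) : a <= b -> abs_cont a b f ->
  {ae mu, forall t, a < t < b -> is_derive t 1 f 0} -> f b = f a.
Proof.
move=> ab fAC [N [mN muN0 fN]].
suff fle e : 0 < e -> `|f b - f a| <= e * (b - a) + e.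
  apply/eqP; rewrite -subr_eq0 -normr_le0; apply/ler_addgt0Pl => e e0.
  have c0 : 0 < b - a + 1 by rewrite ltr_pwDr// subr_ge0.
  rewrite addr0; have := fle (e / (b - a + 1)) (divr_gt0 e0 c0).
  move=> /le_trans; apply.
  by rewrite -[X in _ + X]mulr1 -mulrDr divfK// gt_eqF.
move=> e0; have [d d0 fd] := fAC _ e0.
(* The derivative is assumed only strictly between [a] and [b], so the endpoints are treated as
   exceptional points. *)
pose D := N `|` [set a; b].
have mD : measurable D by apply: measurableU => //; apply: measurableU.
have muD0 : mu D = 0%E.
  apply: null_set_setU => //; first exact: measurableU.
  by apply: null_set_setU => //; exact: lebesgue_measure_set1.
have muDoo : (mu D < +oo)%E by rewrite muD0.
have [U [oU DU muU]] := @lebesgue_regularity_outer R D d mD muDoo d0.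
have mU : measurable U by exact: open_measurable.
have {}muU : (mu U < d%:E)%E.
  rewrite -(setDUK DU) measureU//=; last 2 first.
  - exact: measurableD.
  - by apply/seteqP; split => // x [Dx []].
  by rewrite muD0 add0e.
suff [n [p [q [pq pqI pqU fs]]]] : family_bound f a e U b.
  rewrite (le_trans fs)// lerD2l ltW// fd// -lte_fin.
  apply: (le_lt_trans pqU); apply: le_lt_trans muU.
  by apply: le_measure; rewrite ?inE//; exact: measurableI.
apply: (@interval_induction R a b) => //.
  have p0 : 'I_0 -> R by case.
  exists 0, p0, p0; split => //.
  - by case.
  - by case.
  - by rewrite big_ord0.
  - by rewrite !subrr normr0 mulr0 big_ord0 addr0.
move=> c /andP[ac cb].
have [cU|cU] := pselect (U c).
  have /nbhs_ballP[r/= r0 rU] : nbhs c U by exact: open_nbhs_nbhs.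
  exists r => // s t /andP[as_ sc] /andP[ct tb] crs tcr.
  move=> /family_boundS; apply => //; first exact: ltW.
    exact: le_trans sc ct.
  move=> x /=; rewrite in_itv/= => /andP[sx xt]; apply: rU.
  by rewrite /ball/= ltr_distlC; lra.
have cD : ~ D c by move=> /DU.
have acb : a < c < b.
  rewrite !lt_neqAle ac cb !andbT; apply/andP; split; apply/eqP => E; apply: cD.
    by right; left.
  by right; right.
have fc : is_derive c 1 f 0.
  apply: contrapT => nfc; apply: cD; left; apply: fN => /= h.
  by apply: nfc; exact: h.
have [r r0 fr] : exists2 r, 0 < r & forall y, `|y - c| < r ->
    `|f y - f c| <= e * `|y - c|.
  have [dfc D0] := fc.
  have : h^-1 *: (f (h + c) - f c) @[h --> 0^'] --> (0 : V).
    rewrite -D0.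
    have := dfc; rewrite /derivable /derive => /cvg_ex[l fl].
    have -> : (fun h => h^-1 *: (f (h + c) - f c)) =
      (fun h => h^-1 *: ((f \o shift c) (h *: 1) - f c)).
      by apply/funext => h /=; rewrite /GRing.scale/= mulr1.
    by move: (fl) => /cvg_lim ->.
  move=> /cvgrPdist_le/(_ _ e0)[/= r r0 fr].
  exists r => // y ycr; have [->|yc] := eqVneq y c.
    by rewrite !subrr !normr0 mulr0.
  have yc0 : y - c != 0 by rewrite subr_eq0.
  have := fr (y - c); rewrite /ball_/= sub0r normrN => /(_ ycr yc0).
  by rewrite sub0r normrN normrZ normfV subrK ler_pdivrMl ?normr_gt0// mulrC.
exists r => // s t /andP[as_ sc] /andP[ct tb] crs tcr.
move=> /family_boundW; apply => //; first exact: le_trans sc ct.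
(* As [c] lies between [s] and [t], the two estimates from [c] add up to exactly [e * (t - s)]. *)
rewrite -(subrKA (f c)) (le_trans (ler_normD _ _))//.
rewrite (distrC (f c)).
have -> : e * (t - s) = e * `|t - c| + e * `|s - c|.
  rewrite (ger0_norm (_ : 0 <= t - c)) ?subr_ge0// distrC ger0_norm ?subr_ge0//.
  by rewrite -mulrDr addrA subrK.
apply: lerD; apply: fr; rewrite ltr_distl; lra.
Qed.

End abs_cont_constant.

(** * Stability properties of absolute continuity *)

Section abs_cont_theory.
Context {R : realType}.
Implicit Types (a b : R).

(** Differences, sums, products, matrix entries and Lipschitz functions all reduce to this
    comparison of increments; [K] has no prescribed sign, whence the factor [|K| + 1] in the
    proof. *)
Lemma abs_cont_le2 (V1 V2 V3 : normedModType R) a b (K : R)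
    (f : R -> V1) (g : R -> V2) (h : R -> V3) :
  (forall s t, a <= s -> s <= t -> t <= b ->
    `|h t - h s| <= K * (`|f t - f s| + `|g t - g s|)) ->
  abs_cont a b f -> abs_cont a b g -> abs_cont a b h.
Proof.
move=> hfg fAC gAC e e0.
pose c := e / (2 * (`|K| + 1)).
have K0 : 0 < `|K| + 1 by rewrite ltr_wpDl.
have c0 : 0 < c by rewrite divr_gt0// mulr_gt0.
have [d d0 fd] := fAC _ c0; have [d' d'0 gd] := gAC _ c0.
exists (Num.min d d'); first by rewrite lt_min d0.
move=> n p q pq pqI; rewrite lt_min => /andP[pqd pqd'].
have {}fd := fd n p q pq pqI pqd; have {}gd := gd n p q pq pqI pqd'.
apply: (@le_lt_trans _ _ (\sum_i (`|K| + 1) * (`|f (q i) - f (p i)| + `|g (q i) - g (p i)|))).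
  apply: ler_sum => i _; have [ap [pqi qb]] := pq i.
  rewrite (le_trans (hfg _ _ ap pqi qb))// ler_wpM2r ?addr_ge0//.
  by rewrite (le_trans (ler_norm _))// lerDl.
rewrite -mulr_sumr big_split/= -ltr_pdivlMl//.
rewrite (lt_le_trans (ltrD fd gd))//.
by have -> : c + c = (`|K| + 1)^-1 * e by rewrite /c; field; rewrite gt_eqF.
Qed.

Lemma abs_contB (V : normedModType R) a b (f g : R -> V) :
  abs_cont a b f -> abs_cont a b g -> abs_cont a b (fun t => f t - g t).
Proof.
apply: (@abs_cont_le2 _ _ _ _ _ 1) => s t _ _ _; rewrite mul1r.
by rewrite opprD addrACA -opprD ler_normB.
Qed.

Lemma abs_contD (V : normedModType R) a b (f g : R -> V) :
  abs_cont a b f -> abs_cont a b g -> abs_cont a b (fun t => f t + g t).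
Proof.
apply: (@abs_cont_le2 _ _ _ _ _ 1) => s t _ _ _; rewrite mul1r.
by rewrite opprD addrACA ler_normD.
Qed.

Lemma abs_cont_lipschitz (V : normedModType R) a b (K : R) (f : R -> V) :
  (forall s t, a <= s -> s <= t -> t <= b -> `|f t - f s| <= K * (t - s)) ->
  abs_cont a b f.
Proof.
move=> fK; apply: (@abs_cont_le2 R R _ _ _ K idfun (fun=> 0)).
- move=> s t as_ st tb; rewrite subrr normr0 addr0 ger0_norm ?subr_ge0//.
  exact: fK.
- move=> e e0; exists e => // n p q pq _.
  rewrite (_ : \sum_i _ = \sum_i (q i - p i))//.
  by apply: eq_bigr => i _; rewrite ger0_norm// subr_ge0; case: (pq i) => _ [].
- move=> e e0; exists 1 => // n p q _ _ _.
  by under eq_bigr do rewrite subrr normr0; rewrite big1.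
Qed.

Lemma abs_cont_sum (V : normedModType R) a b n (f : 'I_n -> R -> V) :
  (forall i, abs_cont a b (f i)) -> abs_cont a b (fun t => \sum_i f i t).
Proof.
elim: n f => [f _|n IHn f fAC].
  rewrite (_ : (fun _ => _) = fun=> 0); last by apply/funext => t; rewrite big_ord0.
  by apply: (@abs_cont_lipschitz _ _ _ 0) => s t _ _ _; rewrite subrr normr0 mul0r.
rewrite (_ : (fun _ => _) = fun t => f ord0 t + \sum_i f (lift ord0 i) t).
  by apply: abs_contD => //; exact: IHn.
by apply/funext => t; rewrite big_ord_recl.
Qed.

Lemma abs_cont_bounded (V : normedModType R) a b (f : R -> V) :
  a <= b -> abs_cont a b f ->
  exists K : R, forall t, a <= t <= b -> `|f t| <= K.
Proof.
move=> ab fAC; have [d d0 fd] := fAC 1 ltr01.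
apply: (@interval_induction R a b
  (fun b => exists K, forall t, a <= t <= b -> `|f t| <= K)) => //.
  by exists `|f a| => t ta; rewrite (_ : t = a)//; apply/esym/eqP; rewrite eq_le.
(* With this radius [s] and [t] are less than [d] apart, so the modulus for a single interval lets
   [|f|] grow by at most 1 from [s] on. *)
move=> c cab; exists (d / 2); first by rewrite divr_gt0.
move=> s t /andP[as_ sc] /andP[ct tb] crs tcr [K fK].
exists (K + 1) => x /andP[ax xt]; have [xs|sx] := leP x s.
  by rewrite (le_trans (fK _ _)) ?ax// lerDl.
have := fd 1 (fun=> s) (fun=> x); rewrite !big_ord1 => fxs.
rewrite -(subrK (f s) (f x)) (le_trans (ler_normD _ _))// addrC lerD//.
  by rewrite fK// as_ lexx.
apply/ltW/fxs.
- by move=> _; split; [|split => //]; rewrite ?(ltW sx)// (le_trans xt).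
- by move=> i j _ _ _; rewrite !ord1.
- by move: crs tcr xt; clear; lra.
Qed.

Lemma abs_contM a b (f g : R -> R) : a <= b ->
  abs_cont a b f -> abs_cont a b g -> abs_cont a b (fun t => f t * g t).
Proof.
move=> ab fAC gAC.
have [K fK] := abs_cont_bounded _ _ _ _ ab fAC.
have [M gM] := abs_cont_bounded _ _ _ _ ab gAC.
apply: (@abs_cont_le2 _ _ _ _ _ (Num.max K M) f g) => // s t as_ st tb.
have -> : f t * g t - f s * g s = (f t - f s) * g t + f s * (g t - g s) by ring.
rewrite (le_trans (ler_normD _ _))// !normrM mulrDr lerD//.
  rewrite mulrC ler_wpM2r// (le_trans (gM _ _)) ?le_max ?lexx ?orbT//.
  by rewrite tb (le_trans as_).
rewrite ler_wpM2r// (le_trans (fK _ _)) ?le_max ?lexx//.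
by rewrite as_ (le_trans st).
Qed.

Lemma le_mx_entry m n (A : 'M[R]_(m, n)) i j : `|A i j| <= `|A|.
Proof. by rewrite [leRHS]/Num.Def.normr/= mx_normrE (le_bigmax _ _ (i, j)). Qed.

Lemma mx_norm_le m n (A : 'M[R]_(m, n)) K : 0 <= K ->
  (forall i j, `|A i j| <= K) -> `|A| <= K.
Proof.
by move=> K0 AK; rewrite [leLHS]/Num.Def.normr/= mx_normrE bigmax_le.
Qed.

Lemma abs_cont_entry m n a b (A : R -> 'M[R]_(m, n)) i j :
  abs_cont a b A -> abs_cont a b (fun t => A t i j).
Proof.
move=> AAC; apply: (@abs_cont_le2 _ _ _ _ _ 1 A A) => // s t _ _ _.
have := le_mx_entry _ _ (A t - A s) i j; rewrite !mxE => /le_trans; apply.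
by rewrite mul1r lerDl.
Qed.

End abs_cont_theory.

(** * Primitives of locally bounded measurable functions *)

Section primitive.
Context {R : realType}.
Local Notation mu := (@lebesgue_measure R).
Implicit Types (f g : R -> R).

(** The bound holds at every point, not just almost everywhere; the class is closed under sums,
    products and primitives, hence under Picard steps. *)
Definition loc_bounded_meas f :=
  measurable_fun [set: R] f /\
  forall T, exists K, forall t, `|t| <= T -> `|f t| <= K.

Lemma loc_bounded_meas_continuous f : continuous f -> loc_bounded_meas f.
Proof.
move=> cf; split; first exact: continuous_measurable_fun.
move=> T.
have cT : compact (f @` `[- T, T]).
  by apply: continuous_compact; [exact: continuous_subspaceT|exact: segment_compact].
have [K [_ fK]] := compact_bounded cT.
exists (`|K| + 1) => t tT; apply: fK.
  by rewrite (le_lt_trans (ler_norm _))// ltrDl.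
by exists t => //=; rewrite in_itv/= -ler_norml.
Qed.

Lemma loc_bounded_measD f g : loc_bounded_meas f -> loc_bounded_meas g ->
  loc_bounded_meas (fun t => f t + g t).
Proof.
move=> [mf bf] [mg bg]; split; first exact: measurable_funD.
move=> T; have [K fK] := bf T; have [M gM] := bg T; exists (K + M) => t tT.
by rewrite (le_trans (ler_normD _ _))// lerD// ?fK// gM.
Qed.

Lemma loc_bounded_measM f g : loc_bounded_meas f -> loc_bounded_meas g ->
  loc_bounded_meas (fun t => f t * g t).
Proof.
move=> [mf bf] [mg bg]; split; first exact: measurable_funM.
move=> T; have [K fK] := bf T; have [M gM] := bg T; exists (K * M) => t tT.
by rewrite normrM ler_pM// ?fK// gM.
Qed.

Lemma loc_bounded_meas_sum n (f : 'I_n -> R -> R) :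
  (forall i, loc_bounded_meas (f i)) -> loc_bounded_meas (fun t => \sum_i f i t).
Proof.
elim: n f => [f _|n IHn f bf].
  rewrite (_ : (fun _ => _) = cst 0); last by apply/funext => t; rewrite big_ord0.
  by apply: loc_bounded_meas_continuous => t; exact: cvg_cst.
rewrite (_ : (fun _ => _) = fun t => f ord0 t + \sum_i f (lift ord0 i) t).
  by apply: loc_bounded_measD => //; exact: IHn.
by apply/funext => t; rewrite big_ord_recl.
Qed.

Lemma loc_bounded_meas_integrable f (D : set R) (T : R) : loc_bounded_meas f ->
  measurable D -> D `<=` `[- T, T] -> mu.-integrable D (EFin \o f).
Proof.
move=> [mf bf] mD DT; have [K fK] := bf T.
apply: measurable_bounded_integrable => //.
- apply: (@le_lt_trans _ _ (mu `[- T, T])).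
    by apply: le_measure; rewrite ?inE.
  by rewrite lebesgue_measure_itv/=; case: ifP => _; rewrite ?ltry// -EFinD ltry.
- exact: measurable_funS mf.
- exists K; split; first exact: num_real.
  move=> x Kx t Dt /=; rewrite (le_trans _ (ltW Kx))// fK//.
  by have /= := DT _ Dt; rewrite in_itv/= ler_norml.
Qed.

(** The interval is empty for negative [t], so every primitive is extended by 0 to the left and is
    continuous on the whole line. *)
Definition primitive f (t : R) : R := \int[mu]_(s in `[0, t]) f s.

Let subset_itv0 (t T : R) : t <= T -> `[0, t] `<=` `[- T, T].
Proof.
move=> tT x /=; rewrite !in_itv/= => /andP[x0 xt].
have xT := le_trans xt tT.
by rewrite xT andbT (le_trans _ x0)// oppr_le0 (le_trans x0).
Qed.

Lemma primitive_neg f (t : R) : t < 0 -> primitive f t = 0.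
Proof.
by move=> t0; rewrite /primitive set_itv_ge ?Rintegral_set0// bnd_simp -ltNge.
Qed.

Lemma primitive0 f : primitive f 0 = 0.
Proof. by rewrite /primitive set_itv1 Rintegral_set1. Qed.

Lemma primitiveB f g (t : R) : loc_bounded_meas f -> loc_bounded_meas g ->
  primitive f t - primitive g t = primitive (fun s => f s - g s) t.
Proof.
move=> bf bg; rewrite /primitive RintegralB//;
  exact: loc_bounded_meas_integrable (subset_itv0 _ _ (lexx t)).
Qed.

Lemma primitive_le f g (t : R) : loc_bounded_meas f -> loc_bounded_meas g ->
  (forall s, 0 <= s <= t -> `|f s| <= g s) -> `|primitive f t| <= primitive g t.
Proof.
move=> bf bg fg.
have itf := loc_bounded_meas_integrable _ _ _ bf (measurable_itv _) (subset_itv0 _ _ (lexx t)).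
have itg := loc_bounded_meas_integrable _ _ _ bg (measurable_itv _) (subset_itv0 _ _ (lexx t)).
rewrite (le_trans (le_normr_Rintegral _ _))//.
by apply: le_Rintegral => //; exact: (integrable_norm itf).
Qed.

Lemma primitive_lipschitz f (T K s t : R) : loc_bounded_meas f -> 0 <= T ->
  (forall x, `|x| <= T -> `|f x| <= K) -> s <= t -> t <= T ->
  `|primitive f t - primitive f s| <= K * (t - s).
Proof.
move=> bf T0 fK st tT.
have K0 : 0 <= K by rewrite (le_trans (normr_ge0 (f 0)))// fK// normr0.
(* The set difference handles negative [s] and [t] along with the others: it always lies in
   [[s, t]]. *)
pose D : set R := [set` `[0, t]] `\` [set` `[0, s]].
have mD : measurable D by exact: measurableD.
have tE : [set` `[0, t]] = [set` `[0, s]] `|` D :> set R.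
  apply/seteqP; split => x /=.
    by move=> xt; have [xs|xs] := pselect (`[0, s]%classic x); [left|right].
  move=> [|[]//]; rewrite !in_itv/= => /andP[-> xs].
  exact: le_trans st.
have itf := loc_bounded_meas_integrable _ _ _ bf (measurable_itv _) (subset_itv0 _ _ tT).
have Dt : D `<=` `[0, t] by apply: subDsetl.
have Dst : D `<=` `[s, t].
  move=> x [/=]; rewrite !in_itv/= => /andP[x0 ->] /negP.
  by rewrite x0/= -ltNge => /ltW ->.
have itD : mu.-integrable D (EFin \o f) by exact: integrableS itf.
have muD : (mu D <= (t - s)%:E)%E.
  apply: (@le_trans _ _ (mu `[s, t])); first by apply: le_measure; rewrite ?inE.
  rewrite lebesgue_measure_itv/= lte_fin; case: ifP => // _.
  by rewrite lee_fin subr_ge0.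
rewrite {1}/primitive tE Rintegral_setU//; last 2 first.
- by rewrite -tE.
- by apply/disj_set2P/seteqP; split => // x [? []].
rewrite addrC addKr (le_trans (le_normr_Rintegral _ _))//.
have muDy : (mu D < +oo)%E by apply: le_lt_trans muD _; rewrite ltry.
apply: (@le_trans _ _ (\int[mu]_(x in D) K)).
  apply: le_Rintegral => //.
  - exact: (integrable_norm itD).
  - by apply: measurable_bounded_integrable => //; exact: bounded_cst.
  - move=> x Dx; apply: fK; have := subset_itv0 _ _ tT _ (Dt _ Dx).
    by rewrite /= in_itv/= ler_norml.
rewrite Rintegral_cst// ler_wpM2l// -lee_fin fineK// ge0_fin_numE//.
Qed.

Lemma primitive_continuous f : loc_bounded_meas f -> continuous (primitive f).
Proof.
move=> bf t.
have T0 : 0 <= `|t| + 1 by rewrite addr_ge0.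
have [K fK] := (proj2 bf) (`|t| + 1).
have K0 : 0 <= K by rewrite (le_trans (normr_ge0 (f 0)))// fK// normr0.
apply/cvgrPdist_lt => e e0.
near=> s.
have sT : s <= `|t| + 1.
  by apply/ltW; near: s; apply: lt_nbhsl; rewrite (le_lt_trans (ler_norm t))// ltrDl.
have ts : K * `|t - s| < e.
  rewrite (@le_lt_trans _ _ ((K + 1) * `|t - s|))//; first by rewrite ler_wpM2r// lerDl.
  rewrite -ltr_pdivlMl ?ltr_wpDl//; near: s.
  by apply: cvgr_dist_lt => //; rewrite mulr_gt0// invr_gt0 ltr_wpDl.
apply: le_lt_trans ts; have [st|ts] := leP s t.
  rewrite (@ger0_norm _ (t - s)) ?subr_ge0//; apply: primitive_lipschitz fK _ _ => //.
  by rewrite (le_trans (ler_norm t))// lerDl.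
rewrite distrC (distrC t) (@gtr0_norm _ (s - t)) ?subr_gt0//.
by apply: primitive_lipschitz fK _ _ => //; exact: ltW.
Unshelve. all: by end_near. Qed.

Lemma loc_bounded_meas_primitive f :
  loc_bounded_meas f -> loc_bounded_meas (primitive f).
Proof. by move=> /primitive_continuous; exact: loc_bounded_meas_continuous. Qed.

Lemma primitive_abs_cont f : loc_bounded_meas f -> abs_cont0y (primitive f).
Proof.
move=> bf T T0; have [K fK] := (proj2 bf) T.
by apply: (@abs_cont_lipschitz _ _ _ _ K) => s t _ st tT; exact: primitive_lipschitz fK _ _.
Qed.

Lemma primitive_is_derive f : loc_bounded_meas f ->
  {ae mu, forall t : R, 0 < t -> is_derive t 1 (primitive f) (f t)}.
Proof.
move=> bf.
have itf y : mu.-integrable [set` Interval (BLeft 0) (BRight y)] (EFin \o f).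
  exact: loc_bounded_meas_integrable (subset_itv0 _ _ (lexx y)).
have locf : locally_integrable [set: R] f.
  split; [by case: bf|exact: openT|move=> K _ cK].
  have [M [_ KM]] := compact_bounded cK.
  have KT : K `<=` `[- (`|M| + 1), (`|M| + 1)].
    move=> x Kx; rewrite /= in_itv/= -ler_norml; apply: KM => //.
    by rewrite (le_lt_trans (ler_norm _))// ltrDl.
  have /integrableP[_] := loc_bounded_meas_integrable _ _ _ bf (compact_measurable cK) KT.
  by [].
have := FTC1 itf locf; apply: filterS; first exact: (ae_filter_ringOfSetsType mu).
move=> t ft t0.
have [|df dE] := ft; first by rewrite /= lte_fin.
split; first exact: df.
by rewrite -dE derive1E.
Qed.

(** For nonnegative [t] the integral is [expR (c * t) - 1]. The exponential weight thus reproduces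
    itself under integration at the price of a factor [c], the source of the contraction below. *)
Lemma primitive_expR (c t : R) : 0 < c -> 0 <= t ->
  primitive (fun s => c * expR (c * s)) t <= expR (c * t).
Proof.
move=> c0; rewrite le_eqVlt => /predU1P[<-|t0].
  by rewrite primitive0 expR_ge0.
have dE (x : R) : is_derive x 1 (fun s => expR (c * s)) (c * expR (c * x)).
  by apply: is_derive_eq; rewrite mulrC /GRing.scale/= mulr1 mulrC.
have cE : continuous (fun s : R => expR (c * s)).
  move=> x; apply: differentiable_continuous; apply/derivable1_diffP.
  by case: (dE x).
rewrite /primitive /Rintegral (@continuous_FTC2 _ _ (fun s => expR (c * s)))//=.
- by rewrite mulr0 expR0 lerBlDr lerDl.
- apply: continuous_subspaceT => x; apply: cvgM; first exact: cvg_cst.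
  exact: cE.
- split; first by move=> x _; case: (dE x).
  + exact/cvg_at_right_filter/cE.
  + exact/cvg_at_left_filter/cE.
- by move=> x _; rewrite derive1E; case: (dE x).
Qed.

End primitive.

(** * Linear differential equations by Picard iteration *)

Section linear_ode.
Context {R : realType}.

Lemma cvg_geometric_half (D : R) : D * 2^-1 ^+ n @[n --> \oo] --> (0 : R).
Proof.
rewrite -[X in _ --> X](mulr0 D); apply: cvgM; first exact: cvg_cst.
by apply: cvg_expr; rewrite ger0_norm ?invr_ge0// invf_lt1// ltr1n.
Qed.

Lemma geometric_cauchy (u : R^nat) (D : R) :
  (forall n, `|u n.+1 - u n| <= D * 2^-1 ^+ n) ->
  (u n @[n --> \oo] --> lim (u @ \oo)) /\
  forall n, `|lim (u @ \oo) - u n| <= 2 * D * 2^-1 ^+ n.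
Proof.
move=> uD.
have D0 : 0 <= D by have := le_trans (normr_ge0 _) (uD 0); rewrite expr0 mulr1.
have h0 n : 0 <= 2^-1 ^+ n :> R by rewrite exprn_ge0// invr_ge0.
(* Keeping the exact partial sum of the geometric series, rather than its limit, makes the induction
   close. *)
have uDk n k : `|u (n + k)%N - u n| <= 2 * D * (2^-1 ^+ n - 2^-1 ^+ (n + k)).
  elim: k => [|k IHk]; first by rewrite addn0 !subrr normr0 mulr0.
  rewrite addnS -(subrKA (u (n + k)%N)) (le_trans (ler_normD _ _))//.
  rewrite (le_trans (lerD (uD _) IHk))// exprS le_eqVlt; apply/orP; left.
  by apply/eqP; field.
have uDm n m : (n <= m)%N -> `|u m - u n| <= 2 * D * 2^-1 ^+ n.
  move=> nm; rewrite -(subnKC nm) (le_trans (uDk _ _))//.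
  by rewrite ler_wpM2l ?mulr_ge0// gerBl h0.
have /cauchy_cvgP ucvg : cauchy (u @ \oo).
  apply/cauchy_ballP => e e0.
  have [N _ NE] := (@cvgr0_norm_lt _ _ _ _ _ _ (cvg_geometric_half (2 * D)) (e / 2)
    (divr_gt0 e0 (@ltr0Sn R 1))).
  have hN : 2 * D * 2^-1 ^+ N < e / 2 by rewrite (le_lt_trans (ler_norm _))// NE /=.
  exists (u @` [set n | (N <= n)%N], u @` [set n | (N <= n)%N]).
    by split; exists N => // n Nn; exists n.
  move=> [_ _] [/= [n Nn <-] [m Nm <-]]; rewrite /ball/=.
  rewrite -(subrKA (u N)) (le_lt_trans (ler_normD _ _))// (splitr e) ltrD//.
    by rewrite (le_lt_trans (uDm _ _ Nn)).
  by rewrite distrC (le_lt_trans (uDm _ _ Nm)).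
split => // n.
have ucvgn : `|u m - u n| @[m --> \oo] --> `|lim (u @ \oo) - u n|.
  by apply: cvg_norm; apply: cvgB => //; exact: cvg_cst.
rewrite -(cvg_lim _ ucvgn)//; apply: limr_le; first by apply/cvg_ex; eexists; exact: ucvgn.
by exists n => // m /= /uDm.
Qed.

Section picard.
Context {m n : nat} (Q0 : 'M[R]_(m, n)) (S : R -> 'M[R]_n).
Hypothesis S_lbm : forall i j, loc_bounded_meas (fun t => S t i j).

Let step (Q : R -> 'M[R]_(m, n)) (t : R) : 'M[R]_(m, n) :=
  \matrix_(i, j) (Q0 i j + primitive (fun s => (Q s *m S s) i j) t).

Let Q_ k := iter k step (fun=> Q0).

Let lbm_mul (Q : R -> 'M[R]_(m, n)) :
  (forall i j, loc_bounded_meas (fun t => Q t i j)) ->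
  forall i j, loc_bounded_meas (fun t => (Q t *m S t) i j).
Proof.
move=> Qb i j; rewrite (_ : (fun _ => _) = fun t => \sum_k Q t i k * S t k j).
  by apply: loc_bounded_meas_sum => k; exact: loc_bounded_measM.
by apply/funext => t; rewrite mxE.
Qed.

Let lbm_cst (c : R) : loc_bounded_meas (fun=> c).
Proof. by apply: loc_bounded_meas_continuous => t; exact: cvg_cst. Qed.

Let lbm_step (Q : R -> 'M[R]_(m, n)) : (forall i j, loc_bounded_meas (fun t => Q t i j)) ->
  forall i j, loc_bounded_meas (fun t => step Q t i j).
Proof.
move=> Qb i j; rewrite (_ : (fun _ => _) =
  fun t => Q0 i j + primitive (fun s => (Q s *m S s) i j) t).
  apply: loc_bounded_measD => //; apply: loc_bounded_meas_primitive.
  exact: lbm_mul.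
by apply/funext => t; rewrite mxE.
Qed.

Let lbm_Q k i j : loc_bounded_meas (fun t => Q_ k t i j).
Proof. by elim: k i j => [i j|k IHk]; [exact: lbm_cst|exact: lbm_step]. Qed.

Let S_bounded T : exists2 K, 0 <= K &
  forall t k j, `|t| <= T -> `|S t k j| <= K.
Proof.
have /choice[K SK] : forall kj : 'I_n * 'I_n, exists K : R,
    forall t, `|t| <= T -> `|S t kj.1 kj.2| <= K.
  by move=> [k j]; have [_ /(_ T)] := S_lbm k j.
exists (\sum_kj `|K kj|); first by apply: sumr_ge0.
move=> t k j tT; rewrite (le_trans (SK (k, j) _ tT))//.
rewrite (bigD1 (k, j))//= (le_trans (ler_norm _))// lerDl.
by apply: sumr_ge0.
Qed.

Let mul_bound (A : 'M[R]_(m, n)) (B : 'M[R]_n) a b :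
  (forall i j, `|A i j| <= a) -> (forall i j, `|B i j| <= b) ->
  forall i j, `|(A *m B) i j| <= n%:R * (a * b).
Proof.
move=> Aa Bb i j; rewrite mxE (le_trans (ler_norm_sum _ _ _))//.
apply: (@le_trans _ _ (\sum_(k < n) a * b)).
  by apply: ler_sum => k _; rewrite normrM ler_pM.
by rewrite sumr_const card_ord mulr_natl.
Qed.

(** Multiplication by [S] costs at most [n * K] on entries, while integrating the weight divides by
    [c]; since [c] exceeds [2 * n * K], half of the error remains. The summand 1 keeps [c] positive
    when [n * K] is 0. *)
Let step_contract (T K C : R) (Q Q' : R -> 'M[R]_(m, n)) : 0 <= K -> 0 <= C ->
  (forall t i j, `|t| <= T -> `|S t i j| <= K) ->
  let c := 2 * (n%:R * K + 1) in
  (forall i j, loc_bounded_meas (fun t => Q t i j)) ->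
  (forall i j, loc_bounded_meas (fun t => Q' t i j)) ->
  (forall t i j, 0 <= t <= T -> `|Q' t i j - Q t i j| <= C * expR (c * t)) ->
  forall t i j, t <= T ->
    `|step Q' t i j - step Q t i j| <= C / 2 * expR (c * t).
Proof.
move=> K0 C0 SK c bQ bQ' QQ' t i j tT.
have [t0|t0] := ltP t 0.
  by rewrite !mxE !primitive_neg// subrr normr0 mulr_ge0 ?divr_ge0// expR_ge0.
have c0 : 0 < c by rewrite mulr_gt0// ltr_wpDl// mulr_ge0.
rewrite !mxE opprD addrACA subrr add0r primitiveB; [|exact: lbm_mul..].
have b_exp : loc_bounded_meas (fun s => C / 2 * (c * expR (c * s))).
  apply: loc_bounded_meas_continuous => x.
  apply: cvgM; first exact: cvg_cst.
  apply: cvgM; first exact: cvg_cst.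
  apply: (@continuous_comp _ _ _ (fun s : R => c * s) (@expR R)); last exact: continuous_expR.
  by apply: cvgM; [exact: cvg_cst|exact: cvg_id].
apply: (le_trans (primitive_le _ _ _ _ b_exp _)).
- rewrite (_ : (fun _ => _) = fun s => (Q' s *m S s) i j + -1 * (Q s *m S s) i j).
    apply: loc_bounded_measD; first exact: lbm_mul.
    by apply: loc_bounded_measM; [exact: lbm_cst|exact: lbm_mul].
  by apply/funext => s; rewrite mulN1r.
- move=> s /andP[s0 st]; have sT := le_trans st tT.
  have -> : (Q' s *m S s) i j - (Q s *m S s) i j = ((Q' s - Q s) *m S s) i j.
    by rewrite mulmxBl !mxE.
  apply: (le_trans (mul_bound _ _ (C * expR (c * s)) K _ _ _ _)).
  + by move=> i' j'; rewrite !mxE; apply: QQ'; rewrite s0.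
  + by move=> i' j'; apply: SK; rewrite ger0_norm.
  have -> : C / 2 * (c * expR (c * s)) = n%:R * (C * expR (c * s) * K) + C * expR (c * s).
    by rewrite /c; field.
  by rewrite lerDl mulr_ge0// expR_ge0.
- rewrite /primitive RintegralZl//.
    by rewrite ler_wpM2l ?divr_ge0//; apply: primitive_expR.
  apply: (@loc_bounded_meas_integrable _ _ _ t).
  + apply: loc_bounded_meas_continuous => x.
    apply: cvgM; first exact: cvg_cst.
    apply: (@continuous_comp _ _ _ (fun s : R => c * s) (@expR R)); last exact: continuous_expR.
    by apply: cvgM; [exact: cvg_cst|exact: cvg_id].
  + exact: measurable_itv.
  + move=> x /=; rewrite !in_itv/= => /andP[x0 ->].
    by rewrite (le_trans _ x0)// oppr_le0.
Qed.

Let Q_bound T : exists D, forall k t i j, `|t| <= T ->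
  `|Q_ k.+1 t i j - Q_ k t i j| <= D * 2^-1 ^+ k.
Proof.
have [T0|T0] := ltP T 0.
  exists 0 => k t i j tT; have := le_trans (normr_ge0 _) tT.
  by rewrite leNgt T0.
have [K K0 SK] := S_bounded T.
pose c := 2 * (n%:R * K + 1).
have c0 : 0 < c by rewrite mulr_gt0// ltr_wpDl// mulr_ge0.
(* A bound on the first Picard increment, the integral of [Q0 *m S] over an interval of length at
   most [T]; each further step halves it in the weighted norm. *)
pose C := n%:R * (`|Q0| * K) * T.
have C0 : 0 <= C by rewrite !mulr_ge0.
have Qk k t i j : t <= T ->
    `|Q_ k.+1 t i j - Q_ k t i j| <= C * 2^-1 ^+ k * expR (c * t).
  elim: k t i j => [t i j tT|k IHk t i j tT]; last first.
    rewrite exprSr mulrA; apply: (step_contract T K _ (Q_ k) (Q_ k.+1)) => //.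
    - by rewrite mulr_ge0// exprn_ge0// invr_ge0.

    - by move=> s i' j' /andP[_]; exact: IHk.
  rewrite expr0 mulr1 /= mxE addrC addKr.
  have [t0|t0] := ltP t 0.
    by rewrite primitive_neg// normr0 mulr_ge0// expR_ge0.
  have b : loc_bounded_meas (fun s => (Q0 *m S s) i j).
    by apply: (lbm_mul (fun=> Q0)) => *; exact: lbm_cst.
  rewrite -[X in `|X|]subr0 -(primitive0 (fun s => (Q0 *m S s) i j)).
  apply: (le_trans (primitive_lipschitz _ T (n%:R * (`|Q0| * K)) _ _ b _ _ _ _)) => //.
    move=> x xT; apply: mul_bound; first by move=> i' j'; exact: le_mx_entry.
    by move=> i' j'; exact: SK.
  rewrite subr0 -[leLHS]mulr1 ler_pM ?mulr_ge0//.
    by rewrite /C ler_wpM2l// !mulr_ge0.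
  by rewrite -expR0 ler_expR mulr_ge0// ltW.
exists (C * expR (c * T)) => k t i j tT; have {}tT := le_trans (ler_norm _) tT.
rewrite mulrAC (le_trans (Qk _ _ _ _ tT))// ler_wpM2l//.
  by rewrite mulr_ge0// exprn_ge0// invr_ge0.
by rewrite ler_expR ler_wpM2l// ltW.
Qed.

(* Picard iteration, convergent for the weighted norm
   sup_t e^(-ct) |Q t| on each interval [0, T], c depending on T *)
Lemma linear_ode_integral : exists Q : R -> 'M[R]_(m, n),
  (forall i j, loc_bounded_meas (fun t => Q t i j)) /\
  forall t i j, Q t i j = Q0 i j + primitive (fun s => (Q s *m S s) i j) t.
Proof.
pose Q t : 'M[R]_(m, n) := \matrix_(i, j) lim (Q_ k t i j @[k --> \oo]).
have QQ_ T : exists D, forall k t i j, `|t| <= T ->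
    `|Q t i j - Q_ k t i j| <= D * 2^-1 ^+ k.
  have [D QD] := Q_bound T; exists (2 * D) => k t i j tT.
  rewrite mxE; apply: (proj2 (geometric_cauchy (fun k => Q_ k t i j) D _)).
  by move=> l; exact: QD.
have bQ i j : loc_bounded_meas (fun t => Q t i j).
  split.
    apply: (@measurable_fun_cvg _ _ _ _ (fun k t => Q_ k t i j)).
      by move=> k; case: (lbm_Q k i j).
    move=> t _; have [D QD] := Q_bound `|t|.
    have [+ _] := geometric_cauchy (fun k => Q_ k t i j) D (fun k => QD k t i j (lexx _)).
    by rewrite mxE.
  move=> T; have [D QD] := QQ_ T.
  exists (D + `|Q0 i j|) => t tT; rewrite -(subrK (Q_ 0 t i j) (Q t i j)).
  rewrite (le_trans (ler_normD _ _))// lerD2r.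
  by rewrite (le_trans (QD 0 _ _ _ tT))// expr0 mulr1.
exists Q; split => // t i j.
have [D QD] := QQ_ `|t|.
have [K K0 SK] := S_bounded `|t|.
pose c := 2 * (n%:R * K + 1).
have c0 : 0 < c by rewrite mulr_gt0// ltr_wpDl// mulr_ge0.
have D0 : 0 <= D.
  by have := le_trans (normr_ge0 _) (QD 0 t i j (lexx _)); rewrite expr0 mulr1.
(* Compare through [Q_ k.+1 = step (Q_ k)]: the term [D] bounds the distance from [Q] to this
   iterate, the exponential term that from [step (Q_ k)] to [step Q]. Letting [k] grow shows that
   [Q] is a fixed point. *)
have QE k : `|Q t i j - step Q t i j| <= (D + D / 2 * expR (c * `|t|)) * 2^-1 ^+ k.
  have h0 : 0 <= 2^-1 ^+ k :> R by rewrite exprn_ge0// invr_ge0.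
  rewrite -(subrKA (Q_ k.+1 t i j)) (le_trans (ler_normD _ _))// mulrDl lerD//.
    rewrite (le_trans (QD k.+1 _ _ _ (lexx _)))// ler_wpM2l// exprS ler_piMl//.
    by rewrite invf_le1// ler1n.
  apply: (@le_trans _ _ (D * 2^-1 ^+ k / 2 * expR (c * t))).
    apply: (step_contract `|t| K _ Q (Q_ k)) => //; [by rewrite mulr_ge0| |exact: ler_norm].
    move=> s i' j' /andP[s0 st]; rewrite distrC.
    have st' : `|s| <= `|t| by rewrite ger0_norm.
    rewrite (le_trans (QD k _ _ _ st'))// ler_peMr ?mulr_ge0//.
    by rewrite -/c -expR0 ler_expR mulr_ge0// ltW.
  rewrite [leLHS](_ : _ = D / 2 * expR (c * t) * 2^-1 ^+ k); last by ring.
  rewrite ler_wpM2r// ler_wpM2l ?divr_ge0//.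
  by rewrite ler_expR ler_wpM2l ?ler_norm// ltW.
have -> : Q0 i j + primitive (fun s => (Q s *m S s) i j) t = step Q t i j.
  by rewrite mxE.
apply/eqP; rewrite -subr_eq0 -normr_le0.
have cvg0 := cvg_geometric_half (D + D / 2 * expR (c * `|t|)).
rewrite -(cvg_lim _ cvg0)//; apply: limr_ge; first by apply/cvg_ex; eexists; exact: cvg0.
by apply: nearW => k; exact: QE.
Qed.

End picard.
End linear_ode.

(** * Cross products and positive definiteness of the resistance matrix *)

Section vector_algebra.
Context {R : realType}.
Implicit Types (a b e : 'cV[R]_3) (A : 'M[R]_3).

Lemma sum3E (V : nmodType) (F : 'I_3 -> V) : \sum_i F i = F 0 + F 1 + F 2.
Proof.
rewrite !big_ord_recl big_ord0 addr0 addrA.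
by congr (F _ + F _ + F _); apply/val_inj.
Qed.

Lemma ord3_ind (P : 'I_3 -> Prop) : P 0 -> P 1 -> P 2 -> forall i, P i.
Proof.
move=> P0 P1 P2 [[|[|[|//]]] i3]; [move: P0|move: P1|move: P2];
  by congr P; apply/val_inj.
Qed.

Lemma skew_mx a : Defs.skew a = \matrix_(i, j) (nth [::]
  [:: [:: 0; - a 2 0; a 1 0]; [:: a 2 0; 0; - a 0 0]; [:: - a 1 0; a 0 0; 0]] i)`_j.
Proof.
apply/matrixP; apply: ord3_ind; apply: ord3_ind; rewrite !mxE /=;
  by rewrite ?(mulr0, mulr1, subr0, sub0r, oppr0).
Qed.

Lemma det3E A : \det A =
  A 0 0 * (A 1 1 * A 2 2 - A 1 2 * A 2 1) - A 0 1 * (A 1 0 * A 2 2 - A 1 2 * A 2 0)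
  + A 0 2 * (A 1 0 * A 2 1 - A 1 1 * A 2 0).
Proof.
have det2 (B : 'M[R]_2) : \det B = B 0 0 * B 1 1 - B 0 1 * B 1 0.
  rewrite (expand_det_row _ 0) !big_ord_recl big_ord0 /cofactor !det_mx11 !mxE /=.
  rewrite expr0 mul1r expr1 mulN1r mulrN addr0.
  by congr (B _ _ * B _ _ - B _ _ * B _ _); apply/val_inj.
rewrite (expand_det_row _ 0) sum3E /cofactor !det2 !mxE /=.
rewrite ?(expr0, expr1, mul1r, mulN1r, mulrN) -[(-1) ^+ _]/((-1)^+2) sqrrN expr1n mul1r.
by congr (A _ _ * (A _ _ * A _ _ - A _ _ * A _ _) - A _ _ * (A _ _ * A _ _ - A _ _ * A _ _)
  + A _ _ * (A _ _ * A _ _ - A _ _ * A _ _)); apply/val_inj.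
Qed.

(* The cofactor matrix of [A] is multiplicative for cross products:
   [A a x A b = cof A (a x b)]. *)
Lemma tr_mul_skew_mul A a : A^T *m Defs.skew (A *m a) *m A = \det A *: Defs.skew a.
Proof.
rewrite det3E !skew_mx; apply/matrixP; apply: ord3_ind; apply: ord3_ind;
  do !rewrite !(mxE, sum3E) /=; ring.
Qed.

Lemma tensE a b i j : tens a b i j = a i 0 * b j 0.
Proof. by rewrite mxE big_ord1 !mxE. Qed.

(* The power dissipated by a link of direction [e] when the hinge moves with
   velocity [a] and the link turns with angular velocity [b]. *)
Definition dissipation (L Cpar Cperp : R) e a b : R :=
  let s := e 0 0 * a 0 0 + e 1 0 * a 1 0 + e 2 0 * a 2 0 in
  let c := cross b e in
  L * Cpar * s ^+ 2 + L * Cperp *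
    ((a 0 0 - s * e 0 0 + L / 2 * c 0 0) ^+ 2 +
     (a 1 0 - s * e 1 0 + L / 2 * c 1 0) ^+ 2 +
     (a 2 0 - s * e 2 0 + L / 2 * c 2 0) ^+ 2 +
     L ^+ 2 / 12 * (c 0 0 ^+ 2 + c 1 0 ^+ 2 + c 2 0 ^+ 2)).

Lemma dissipation_ge0 (L Cpar Cperp : R) e a b : 0 < L -> 0 < Cpar -> 0 < Cperp ->
  0 <= dissipation L Cpar Cperp e a b.
Proof.
move=> L0 Cpar0 Cperp0; rewrite addr_ge0//.
  by rewrite mulr_ge0 ?sqr_ge0// mulr_ge0// ltW.
rewrite mulr_ge0//; first by rewrite mulr_ge0// ltW.
have L12 : 0 <= L ^+ 2 / 12 by rewrite divr_ge0// sqr_ge0.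
by rewrite !addr_ge0 ?sqr_ge0// mulr_ge0// !addr_ge0// sqr_ge0.
Qed.

Lemma dissipation_eq0 (L Cpar Cperp : R) e a b : 0 < L -> 0 < Cpar -> 0 < Cperp ->
  dissipation L Cpar Cperp e a b = 0 -> a = 0 /\ cross b e = 0.
Proof.
move=> L0 Cpar0 Cperp0; rewrite /dissipation.
set s := e 0 0 * _ + _ + _; set c := cross b e.
have LCpar : 0 < L * Cpar by rewrite mulr_gt0.
have LCperp : 0 < L * Cperp by rewrite mulr_gt0.
have L12 : 0 < L ^+ 2 / 12 by rewrite divr_gt0// exprn_gt0.
have c2 : 0 <= c 0 0 ^+ 2 + c 1 0 ^+ 2 + c 2 0 ^+ 2 by rewrite !addr_ge0// sqr_ge0.
have Lc2 := mulr_ge0 (ltW L12) c2.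
move=> /eqP; rewrite paddr_eq0; last 2 first.
- by rewrite mulr_ge0 ?sqr_ge0// ltW.
- by rewrite mulr_ge0 ?(ltW LCperp)// !addr_ge0// sqr_ge0.
rewrite mulf_eq0 gt_eqF//= expf_eq0/= => /andP[/eqP s0].
rewrite mulf_eq0 gt_eqF//= s0 !mul0r !subr0.
have sq2 (u v w : R) : u ^+ 2 + v ^+ 2 + w ^+ 2 = 0 -> [/\ u = 0, v = 0 & w = 0].
  move=> /eqP; rewrite !paddr_eq0 ?addr_ge0 ?sqr_ge0// !expf_eq0/=.
  by move=> /andP[/andP[/eqP ? /eqP ?] /eqP ?].
rewrite paddr_eq0 ?Lc2 ?addr_ge0 ?sqr_ge0// mulf_eq0 (gt_eqF L12)/=.
move=> /andP[/eqP/sq2[a0 a1 a2] /eqP/sq2[c0 c1 c2']].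
move: a0 a1 a2; rewrite c0 c1 c2' mulr0 !addr0 => a0 a1 a2.
by split; apply/colP; apply: ord3_ind; rewrite ?a0 ?a1 ?a2 ?c0 ?c1 ?c2' mxE.
Qed.

(** The point of a link at distance [r] from the hinge moves with velocity [a + r (b x e)].
    Integrating the square of its normal component over [[0, L]] and completing the square at the
    midpoint produces the [L / 2] and [L ^+ 2 / 12] of [dissipation]; the last term is the torsional
    drag of the first link. *)
Lemma grand_resistance_quadratic (L Cpar Cperp Ctau th ph : R) (x y : 'rV[R]_3) :
  (row_mx x y *m grand_resistance L Cpar Cperp Ctau th ph *m (row_mx x y)^T) 0 0 =
  dissipation L Cpar Cperp link1 x^T y^T +
  dissipation L Cpar Cperp (link2 th ph) x^T y^T + L * Ctau * y 0 2 ^+ 2.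
Proof.
rewrite /grand_resistance mul_row_block tr_row_mx mul_row_col.
rewrite /resK /resC /resJ /links !big_cons !big_nil !addr0.
have : link2 th ph 0 0 ^+ 2 + link2 th ph 1 0 ^+ 2 + link2 th ph 2 0 ^+ 2 = 1.
  rewrite !mxE /= !exprMn -mulrDr cos2Dsin2 mulr1 addrC cos2Dsin2.
  by [].
move: (link2 th ph) => e e1.
rewrite /dissipation.
do !rewrite !(skew_mx, tensE, mxE, sum3E) /=.
apply: subr0_eq.
(* Before [|e| = 1] is used, the two sides differ by this multiple of [1 - |e|^2]: one summand comes
   from the square of the normal part of [x], the other from
   [|y x e|^2 = |y|^2 |e|^2 - (y . e)^2]. *)
transitivity ((1 - (e 0 0 ^+ 2 + e 1 0 ^+ 2 + e 2 0 ^+ 2)) *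
  (L * Cperp * (e 0 0 * x 0 0 + e 1 0 * x 0 1 + e 2 0 * x 0 2) ^+ 2
   + L ^+ 3 / 3 * Cperp * (y 0 0 ^+ 2 + y 0 1 ^+ 2 + y 0 2 ^+ 2))); last first.
  by rewrite e1 subrr mul0r.
move: (e 0 0) (e 1 0) (e 2 0) (x 0 0) (x 0 1) (x 0 2) (y 0 0) (y 0 1) (y 0 2).
by clear => *; field.
Qed.

(** A kernel vector dissipates no power. The drag on the first link forces [x = 0] and [y] parallel
    to that link; torsion removes the remaining component. When the links are collinear, torsion
    alone resists a rotation about their common axis. *)
Lemma grand_resistance_unit (L Cpar Cperp Ctau th ph : R) :
  0 < L -> 0 < Cpar -> 0 < Cperp -> 0 < Ctau ->
  grand_resistance L Cpar Cperp Ctau th ph \in unitmx.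
Proof.
move=> L0 Cpar0 Cperp0 Ctau0; rewrite -row_free_unit; apply: inj_row_free => u.
rewrite -(hsubmxK u); move: (lsubmx u) (rsubmx u) => {u} x y uM0.
have := grand_resistance_quadratic L Cpar Cperp Ctau th ph x y.
rewrite uM0 mul0mx mxE => /esym/eqP.
have LC0 : 0 < L * Ctau by rewrite mulr_gt0.
have Ly : 0 <= L * Ctau * y 0 2 ^+ 2 by rewrite mulr_ge0 ?sqr_ge0// ltW.
have D1 := dissipation_ge0 _ _ _ link1 x^T y^T L0 Cpar0 Cperp0.
have D2 := dissipation_ge0 _ _ _ (link2 th ph) x^T y^T L0 Cpar0 Cperp0.
rewrite (paddr_eq0 (addr_ge0 D1 D2) Ly) (paddr_eq0 D1 D2) mulf_eq0 (gt_eqF LC0)/=.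
rewrite expf_eq0/= => /andP[/andP[/eqP D0 _] /eqP y2].
have [x0 ye] := dissipation_eq0 _ _ _ _ _ _ L0 Cpar0 Cperp0 D0.
have y0 : y 0 0 = 0.
  by have /colP/(_ 1) := ye; rewrite !mxE /= mulr0 sub0r mulr1 => /eqP; rewrite oppr_eq0 => /eqP.
have y1 : y 0 1 = 0.
  by have /colP/(_ 0) := ye; rewrite !mxE /= mulr0 subr0 mulr1.
have -> : x = 0 by rewrite -[x]trmxK x0 trmx0.
have -> : y = 0 by apply/rowP; apply: ord3_ind; rewrite mxE.
by rewrite row_mx0.
Qed.

End vector_algebra.

(** * Entrywise continuity of matrix-valued functions *)

Section entrywise_continuity.
Context {R : realType}.

Definition mx_continuous m n (A : R -> 'M[R]_(m, n)) :=
  forall i j, continuous (fun t => A t i j).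

Lemma mx_continuous_cst m n (A : 'M[R]_(m, n)) : mx_continuous m n (fun=> A).
Proof. by move=> i j t; exact: cvg_cst. Qed.

Lemma mx_continuousD m n (A B : R -> 'M[R]_(m, n)) :
  mx_continuous m n A -> mx_continuous m n B ->
  mx_continuous m n (fun t => A t + B t).
Proof.
move=> cA cB i j; rewrite (_ : (fun _ => _) = fun t => A t i j + B t i j).
  by move=> t; apply: cvgD; [exact: cA|exact: cB].
by apply/funext => t; rewrite mxE.
Qed.

Lemma mx_continuousN m n (A : R -> 'M[R]_(m, n)) :
  mx_continuous m n A -> mx_continuous m n (fun t => - A t).
Proof.
move=> cA i j; rewrite (_ : (fun _ => _) = fun t => - A t i j).
  by move=> t; apply: cvgN; exact: cA.
by apply/funext => t; rewrite mxE.
Qed.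

Lemma mx_continuousZ m n (f : R -> R) (A : R -> 'M[R]_(m, n)) :
  continuous f -> mx_continuous m n A -> mx_continuous m n (fun t => f t *: A t).
Proof.
move=> cf cA i j; rewrite (_ : (fun _ => _) = fun t => f t * A t i j).
  by move=> t; apply: cvgM; [exact: cf|exact: cA].
by apply/funext => t; rewrite mxE.
Qed.

Lemma continuous_bigsum (I : Type) (s : seq I) (P : pred I) (f : I -> R -> R) :
  (forall i, continuous (f i)) -> continuous (fun t => \sum_(i <- s | P i) f i t).
Proof. by move=> cf; apply: continuous_big => [|i _]; [exact: add_continuous|exact: cf]. Qed.

Lemma continuous_bigprod (I : Type) (s : seq I) (P : pred I) (f : I -> R -> R) :
  (forall i, continuous (f i)) -> continuous (fun t => \prod_(i <- s | P i) f i t).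
Proof. by move=> cf; apply: continuous_big => [|i _]; [exact: mul_continuous|exact: cf]. Qed.

Lemma mx_continuousM m n p (A : R -> 'M[R]_(m, n)) (B : R -> 'M[R]_(n, p)) :
  mx_continuous m n A -> mx_continuous n p B ->
  mx_continuous m p (fun t => A t *m B t).
Proof.
move=> cA cB i j; rewrite (_ : (fun _ => _) = fun t => \sum_k A t i k * B t k j).
  apply: continuous_bigsum => k t.
  by apply: cvgM; [exact: cA|exact: cB].
by apply/funext => t; rewrite mxE.
Qed.

Lemma mx_continuous_tr m n (A : R -> 'M[R]_(m, n)) :
  mx_continuous m n A -> mx_continuous n m (fun t => (A t)^T).
Proof.
move=> cA i j; rewrite (_ : (fun _ => _) = fun t => A t j i); first exact: cA.
by apply/funext => t; rewrite mxE.
Qed.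

Lemma mx_continuous_col m1 m2 n (A : R -> 'M[R]_(m1, n)) (B : R -> 'M[R]_(m2, n)) :
  mx_continuous m1 n A -> mx_continuous m2 n B ->
  mx_continuous (m1 + m2) n (fun t => col_mx (A t) (B t)).
Proof.
move=> cA cB i j; case: (split_ordP i) => k ->.
  rewrite (_ : (fun _ => _) = fun t => A t k j); first exact: cA.
  by apply/funext => t; rewrite col_mxEu.
rewrite (_ : (fun _ => _) = fun t => B t k j); first exact: cB.
by apply/funext => t; rewrite col_mxEd.
Qed.

Lemma mx_continuous_row m n1 n2 (A : R -> 'M[R]_(m, n1)) (B : R -> 'M[R]_(m, n2)) :
  mx_continuous m n1 A -> mx_continuous m n2 B ->
  mx_continuous m (n1 + n2) (fun t => row_mx (A t) (B t)).
Proof.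
move=> cA cB i j; case: (split_ordP j) => k ->.
  rewrite (_ : (fun _ => _) = fun t => A t i k); first exact: cA.
  by apply/funext => t; rewrite row_mxEl.
rewrite (_ : (fun _ => _) = fun t => B t i k); first exact: cB.
by apply/funext => t; rewrite row_mxEr.
Qed.

Lemma continuous_det n (A : R -> 'M[R]_n) :
  mx_continuous n n A -> continuous (fun t => \det (A t)).
Proof.
move=> cA; apply: continuous_bigsum => s t.
by apply: cvgM; [exact: cvg_cst|apply: continuous_bigprod => i; exact: cA].
Qed.

Lemma mx_continuous_inv n (A : R -> 'M[R]_n) :
  (forall t, A t \in unitmx) -> mx_continuous n n A ->
  mx_continuous n n (fun t => invmx (A t)).
Proof.
move=> uA cA; rewrite (_ : (fun t => _) = fun t => (\det (A t))^-1 *: \adj (A t)).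
  apply: mx_continuousZ.
    move=> t; apply: cvgV; last exact: continuous_det.
    by have := uA t; rewrite unitmxE unitfE.
  move=> i j; rewrite (_ : (fun _ => _) = fun t => (-1) ^+ (j + i) * \det (row' j (col' i (A t)))).
    move=> t; apply: cvgM; first exact: cvg_cst.
    apply: continuous_det => k l.
    rewrite (_ : (fun _ => _) = fun t => A t (lift j k) (lift i l)); first exact: cA.
    by apply/funext => x; rewrite !mxE.
  by apply/funext => t; rewrite mxE.
by apply/funext => t; rewrite /invmx uA.
Qed.

Lemma mx_continuous_vec3 (f g h : R -> R) :
  continuous f -> continuous g -> continuous h ->
  mx_continuous 3 1 (fun t => vec3 (f t) (g t) (h t)).
Proof.
move=> cf cg ch i j; move: i; apply: ord3_ind.
- by rewrite (_ : (fun _ => _) = f)//; apply/funext => t; rewrite mxE.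
- by rewrite (_ : (fun _ => _) = g)//; apply/funext => t; rewrite mxE.
- by rewrite (_ : (fun _ => _) = h)//; apply/funext => t; rewrite mxE.
Qed.

Lemma mx_continuous_skew (a : R -> 'cV[R]_3) :
  mx_continuous 3 1 a -> mx_continuous 3 3 (fun t => Defs.skew (a t)).
Proof.
move=> ca i j; rewrite (_ : (fun _ => _) = fun t => cross (a t) (delta_mx j 0) i 0).
  apply: mx_continuous_vec3 => t; apply: cvgB; apply: cvgM; try exact: cvg_cst; exact: ca.
by apply/funext => t; rewrite mxE.
Qed.

End entrywise_continuity.

(** * Continuity of [v1] and [v2] along a shape curve *)

Section shape_continuity.
Context {R : realType} (L Cpar Cperp Ctau : R).
Hypotheses (L_gt0 : 0 < L) (Cpar_gt0 : 0 < Cpar) (Cperp_gt0 : 0 < Cperp) (Ctau_gt0 : 0 < Ctau).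
Variables (th ph : R -> R).
Hypotheses (cth : continuous th) (cph : continuous ph).

Let csin {f : R -> R} : continuous f -> continuous (fun t => sin (f t)).
Proof. by move=> cf t; apply: continuous_comp; [exact: cf|exact: continuous_sin]. Qed.

Let ccos {f : R -> R} : continuous f -> continuous (fun t => cos (f t)).
Proof. by move=> cf t; apply: continuous_comp; [exact: cf|exact: continuous_cos]. Qed.

Let ccst (c : R) : continuous (fun _ : R => c).
Proof. by move=> t; exact: cvg_cst. Qed.

Let cmul {f g : R -> R} : continuous f -> continuous g -> continuous (fun t => f t * g t).
Proof. by move=> cf cg t; apply: cvgM; [exact: cf|exact: cg]. Qed.

Let copp {f : R -> R} : continuous f -> continuous (fun t => - f t).
Proof. by move=> cf t; apply: cvgN; exact: cf. Qed.

Let link2_continuous : mx_continuous 3 1 (fun t => link2 (th t) (ph t)).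
Proof. apply: mx_continuous_vec3; last exact: ccos.
  exact: cmul (csin cph) (ccos cth).
exact: cmul (csin cph) (csin cth). Qed.

Let tens_continuous (a b : R -> 'cV[R]_3) : mx_continuous 3 1 a -> mx_continuous 3 1 b ->
  mx_continuous 3 3 (fun t => tens (a t) (b t)).
Proof. by move=> ca cb; apply: mx_continuousM => //; exact: mx_continuous_tr. Qed.

Lemma grand_resistance_continuous :
  mx_continuous (3 + 3) (3 + 3) (fun t => grand_resistance L Cpar Cperp Ctau (th t) (ph t)).
Proof.
have cC : mx_continuous 3 3 (fun t => resC L Cperp (th t) (ph t)).
  rewrite /resC /links; under eq_fun do rewrite !big_cons big_nil addr0.
  apply: mx_continuousZ => //; apply: mx_continuousD; apply: mx_continuous_skew => //.
rewrite /grand_resistance /block_mx.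
apply: mx_continuous_col; apply: mx_continuous_row => //.
- rewrite /resK /links; under eq_fun do rewrite !big_cons big_nil addr0.
  apply: mx_continuousZ => //; apply: mx_continuousD; apply: mx_continuousD;
    try exact: mx_continuous_cst.
  by apply: mx_continuousZ => //; exact: tens_continuous.
- exact: mx_continuous_tr.
- rewrite /resJ /links; under eq_fun do rewrite !big_cons big_nil addr0.
  apply: mx_continuousD; last exact: mx_continuous_cst.
  apply: mx_continuousZ => //; apply: mx_continuousD; first exact: mx_continuous_cst.
  apply: mx_continuousD; first exact: mx_continuous_cst.
  by apply: mx_continuousN; exact: tens_continuous.
Qed.

Lemma v1_continuous : mx_continuous (3 + 3) 1 (fun t => v1 L Cpar Cperp Ctau (th t) (ph t)).
Proof.
apply: mx_continuousM.
  apply: mx_continuous_inv; last exact: grand_resistance_continuous.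
  by move=> t; exact: grand_resistance_unit.
apply: mx_continuous_col; apply: mx_continuous_vec3.
- exact: copp (cmul (cmul (ccst _) (ccos cth)) (ccos cph)).
- exact: copp (cmul (cmul (ccst _) (csin cth)) (ccos cph)).
- exact: cmul (ccst _) (csin cph).
- exact: cmul (ccst _) (csin cth).
- exact: copp (cmul (ccst _) (ccos cth)).
- exact: ccst.
Qed.

Lemma v2_continuous : mx_continuous (3 + 3) 1 (fun t => v2 L Cpar Cperp Ctau (th t) (ph t)).
Proof.
apply: mx_continuousM.
  apply: mx_continuous_inv; last exact: grand_resistance_continuous.
  by move=> t; exact: grand_resistance_unit.
apply: mx_continuous_col; apply: mx_continuous_vec3.
- exact: cmul (cmul (ccst _) (csin cth)) (csin cph).
- exact: copp (cmul (cmul (ccst _) (ccos cth)) (csin cph)).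
- exact: ccst.
- exact: cmul (cmul (ccst _) (ccos cth)) (csin (cmul (ccst _) cph)).
- exact: cmul (cmul (ccst _) (csin cth)) (csin (cmul (ccst _) cph)).
- exact: copp (cmul (ccst _) (cmul (csin cph) (csin cph))).
Qed.

End shape_continuity.

(** * Matrix-valued primitives *)

Section mx_primitive.
Context {R : realType}.
Local Notation mu := (@lebesgue_measure R).

Lemma ae_sub (P Q : R -> Prop) : (forall t, P t -> Q t) ->
  {ae mu, forall t, P t} -> {ae mu, forall t, Q t}.
Proof.
by move=> PQ [A [mA A0 PA]]; exists A; split => // t nQ; apply: PA => Pt; exact/nQ/PQ.
Qed.

Lemma ae_and (P Q : R -> Prop) : {ae mu, forall t, P t} -> {ae mu, forall t, Q t} ->
  {ae mu, forall t, P t /\ Q t}.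
Proof.
have F : Filter (almost_everywhere mu) by exact: ae_filter_ringOfSetsType.
by move=> aP aQ; exact: filterI.
Qed.

Lemma is_derive_entry m n (A : R -> 'M[R]_(m, n)) (D : 'M[R]_(m, n)) (t : R) i j :
  is_derive t 1 A D -> is_derive t 1 (fun s => A s i j) (D i j).
Proof.
move=> [dA DA]; split; first exact: ((derivable_mxP _ _ _).1 dA).
by rewrite -DA derive_mx// mxE.
Qed.

(** [X] enters through an integral equation instead of being defined from [F], because [F] may
    itself involve [X], as in [F = Q S] for the rotation. *)
Lemma mx_primitive_continuous m n (X0 : 'M[R]_(m, n)) (F X : R -> 'M[R]_(m, n)) :
  (forall i j, loc_bounded_meas (fun t => F t i j)) ->
  (forall t i j, X t i j = X0 i j + primitive (fun s => F s i j) t) ->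
  mx_continuous m n X.
Proof.
move=> bF XE i j; rewrite (_ : (fun _ => _) = fun t => X0 i j + primitive (fun s => F s i j) t).
  by move=> t; apply: cvgD; [exact: cvg_cst|exact: primitive_continuous].
by apply/funext => t; rewrite XE.
Qed.

Lemma mx_primitive0 m n (X0 : 'M[R]_(m, n)) (F X : R -> 'M[R]_(m, n)) :
  (forall t i j, X t i j = X0 i j + primitive (fun s => F s i j) t) -> X 0 = X0.
Proof. by move=> XE; apply/matrixP => i j; rewrite XE primitive0 addr0. Qed.

Lemma mx_primitive_abs_cont m n (X0 : 'M[R]_(m, n)) (F X : R -> 'M[R]_(m, n)) :
  (forall i j, loc_bounded_meas (fun t => F t i j)) ->
  (forall t i j, X t i j = X0 i j + primitive (fun s => F s i j) t) ->
  abs_cont0y X.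
Proof.
move=> bF XE T T0.
have /choice[K FK] : forall ij : 'I_m * 'I_n, exists K : R,
    forall t, `|t| <= T -> `|F t ij.1 ij.2| <= K.
  by move=> [i j]; have [_ /(_ T)] := bF i j.
have K0 ij : 0 <= K ij by rewrite (le_trans (normr_ge0 _) (FK ij 0 _))// normr0.
apply: (@abs_cont_lipschitz _ _ _ _ (\sum_ij K ij)) => s t _ st tT.
have ts : 0 <= t - s by rewrite subr_ge0.
apply: mx_norm_le; first by rewrite mulr_ge0// sumr_ge0.
move=> i j; rewrite !mxE !XE opprD addrACA subrr add0r.
apply: (le_trans (primitive_lipschitz _ _ _ _ _ (bF i j) T0 (FK (i, j)) st tT)).
by rewrite ler_wpM2r// (bigD1 (i, j))//= lerDl sumr_ge0.
Qed.

Lemma mx_primitive_is_derive m n (X0 : 'M[R]_(m, n)) (F X : R -> 'M[R]_(m, n)) :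
  (forall i j, loc_bounded_meas (fun t => F t i j)) ->
  (forall t i j, X t i j = X0 i j + primitive (fun s => F s i j) t) ->
  {ae mu, forall t : R, 0 < t -> is_derive t 1 X (F t)}.
Proof.
move=> bF XE.
have := fun ij : 'I_m * 'I_n => primitive_is_derive _ (bF ij.1 ij.2).
move=> /(@filter_forall _ _ _ _ (ae_filter_ringOfSetsType mu)).
apply: ae_sub => t dF t0.
have dX i j : is_derive t 1 (fun t => X t i j) (F t i j).
  rewrite (_ : (fun _ => _) = cst (X0 i j) + primitive (fun s => F s i j)).
    have dFij := dF (i, j) t0.
    by apply: is_derive_eq; rewrite add0r.
  by apply/funext => s; rewrite XE.
have derX : derivable X t 1 by apply/derivable_mxP => i j; case: (dX i j).
split => //; rewrite derive_mx//; apply/matrixP => i j; rewrite mxE.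
by case: (dX i j).
Qed.

End mx_primitive.

(** * Bounded representatives of the controls *)

Section bounded_control.
Context {R : realType}.
Local Notation mu := (@lebesgue_measure R).

(** Truncating at an essential bound preserves measurability and alters the control on ]0, +oo[ only
    on a null set, which equations required almost everywhere do not see. *)
Lemma Linfty0y_bounded (u : R -> R) : Linfty0y u ->
  exists2 w : R -> R, loc_bounded_meas w &
    {ae mu, forall t : R, 0 < t -> w t = u t}.
Proof.
rewrite /Linfty0y; set f := u \_ _ => /andP[].
rewrite inE /= => mf; rewrite inE /= /finite_norm unlock.
(* The unfolded norm branches on whether the whole space has positive measure. *)
have mu0 : (0 < mu [set: R])%E.
  apply: (@lt_le_trans _ _ (mu `[0, 1])); last by apply: le_measure; rewrite ?inE.
  by rewrite lebesgue_measure_itv/= lte_fin ltr01 oppr0 adde0 lte_fin ltr01.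
rewrite mu0 => foo.
have [M fM] := @ess_supr_bounded _ _ _ mu (fun t => `|f t|) foo.
pose w t := Num.max (- `|M|) (Num.min `|M| (f t)).
exists w.
  split.
    apply: measurable_maxr; first exact: measurable_cst.
    by apply: measurable_minr => //; exact: measurable_cst.
  move=> T; exists `|M| => t _; rewrite ler_norml le_max lexx/= ge_max ge_min lexx/= andbT.
  by rewrite (le_trans _ (normr_ge0 M))// oppr_le0.
apply: ae_sub fM => t /= ftM t0.
have ftM' : `|f t| <= `|M| by rewrite (le_trans ftM)// ler_norm.
move: ftM'; rewrite ler_norml => /andP[Mf fM].
rewrite /w min_r// max_r// /f patchE mem_set//=.
by rewrite in_itv/= t0.
Qed.

End bounded_control.

(** * Uniqueness from almost everywhere derivatives *)

Section uniqueness.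
Context {R : realType}.
Local Notation mu := (@lebesgue_measure R).

Lemma abs_cont0y_derive_eq (V : normedModType R) (f g h : R -> V) :
  abs_cont0y f -> abs_cont0y g ->
  {ae mu, forall t : R, 0 < t -> is_derive t 1 f (h t)} ->
  {ae mu, forall t : R, 0 < t -> is_derive t 1 g (h t)} ->
  f 0 = g 0 -> forall t, 0 <= t -> f t = g t.
Proof.
move=> fAC gAC df dg fg0 t t0; apply/eqP; rewrite -subr_eq0; apply/eqP.
have <- : f 0 - g 0 = 0 by rewrite fg0 subrr.
apply: (@abs_cont_constant _ _ (fun t => f t - g t)) => //.
  by apply: abs_contB; [exact: fAC|exact: gAC].
apply: ae_sub (ae_and _ _ df dg) => s [dfs dgs] /andP[s0 _].
have dfs' := dfs s0; have dgs' := dgs s0.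
by apply: is_derive_eq; rewrite subrr.
Qed.

(** As [S] acts from the right, the two derivatives meet in the middle:
    [(P Q^T)' = P (S + S^T) Q^T]. *)
Lemma skew_flow_orthogonal n (P Q S : R -> 'M[R]_n) :
  abs_cont0y P -> abs_cont0y Q -> (forall t, (S t)^T = - S t) ->
  {ae mu, forall t : R, 0 < t -> is_derive t 1 P (P t *m S t)} ->
  {ae mu, forall t : R, 0 < t -> is_derive t 1 Q (Q t *m S t)} ->
  forall t, 0 <= t -> P t *m (Q t)^T = P 0 *m (Q 0)^T.
Proof.
move=> PAC QAC Sskew dP dQ t t0; apply/matrixP => i j.
pose g s := \sum_k P s i k * Q s j k.
have gE s : (P s *m (Q s)^T) i j = g s.
  by rewrite mxE; apply: eq_bigr => k _; rewrite mxE.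
rewrite !gE; apply: (@abs_cont_constant _ _ g) => //.
  apply: abs_cont_sum => k; apply: abs_contM => //; apply: abs_cont_entry.
    exact: PAC.
  exact: QAC.
apply: ae_sub (ae_and _ _ dP dQ) => s [dPs dQs] /andP[s0 _].
have {}dPs := dPs s0; have {}dQs := dQs s0.
have dPe k := is_derive_entry _ _ _ _ _ i k dPs.
have dQe k := is_derive_entry _ _ _ _ _ j k dQs.
have -> : g = \sum_k ((fun s => P s i k) * (fun s => Q s j k)).
  by apply/funext => r; rewrite fct_sumE.
apply: is_derive_eq.
rewrite big_split/=.
have -> : \sum_k P s i k *: (Q s *m S s) j k = (P s *m (Q s *m S s)^T) i j.
  by rewrite [RHS]mxE; apply: eq_bigr => k _; rewrite [(_ ^T) _ _]mxE /GRing.scale/=.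
have -> : \sum_k Q s j k *: (P s *m S s) i k = (P s *m S s *m (Q s)^T) i j.
  by rewrite [RHS]mxE; apply: eq_bigr => k _; rewrite [(_ ^T) _ _]mxE /GRing.scale/= mulrC.
by rewrite trmx_mul Sskew mulNmx mulmxN mulmxA mxE addNr.
Qed.

End uniqueness.

(** * Rotations and angular velocity *)

Section rotations.
Context {R : realType}.

Lemma rotation_tr (Q : 'M[R]_3) : is_rotation Q ->
  [/\ Q \in unitmx, invmx Q = Q^T & Q *m Q^T = 1%:M].
Proof.
move=> [QQ _]; have QQ' := mulmx1C QQ.
have [uQ _] := mulmx1_unit QQ'; split => //.
by rewrite -[RHS]mulmx1 -(mulmxV uQ) mulmxA QQ mul1mx.
Qed.

Lemma rotation_skew (Q : 'M[R]_3) a : is_rotation Q ->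
  Defs.skew (Q *m a) *m Q = Q *m Defs.skew a.
Proof.
move=> rQ; have [_ _ QQt] := rotation_tr _ rQ; case: rQ => _ dQ.
have := tr_mul_skew_mul Q a; rewrite dQ scale1r => <-.
by rewrite !mulmxA QQt mul1mx.
Qed.

Lemma tr_skew (a : 'cV[R]_3) : (Defs.skew a)^T = - Defs.skew a.
Proof.
by rewrite skew_mx; apply/matrixP; apply: ord3_ind; apply: ord3_ind;
  rewrite !mxE /= ?opprK ?oppr0.
Qed.

(** Passing to the co-moving frame by [w = Q b] turns the defining relation of the angular velocity
    into an equation linear in [Q]; conjugation by a rotation carries the skew matrix of [b] to that
    of [Q b]. *)
Lemma angular_velocityP (Q D : 'M[R]_3) b : is_rotation Q ->
  (exists w, (forall v, D *m invmx Q *m v = cross w v) /\ invmx Q *m w = b) <->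
  D = Q *m Defs.skew b.
Proof.
move=> rQ; have [uQ _ _] := rotation_tr _ rQ; split.
- move=> [w [Dw <-]].
  have DE : D *m invmx Q = Defs.skew w.
    apply/matrixP => i j; have := Dw (delta_mx j 0).
    by rewrite -skewE -!colE => /colP/(_ i); rewrite !mxE.
  by rewrite -rotation_skew// mulmxA mulmxV// mul1mx -DE -mulmxA mulVmx// mulmx1.
- move=> ->; exists (Q *m b); split; last by rewrite mulmxA mulVmx// mul1mx.
  by move=> v; rewrite -skewE -rotation_skew// mulmxK.
Qed.

End rotations.

(** * Uniqueness for the swimmer *)

Section solutions.
Context {R : realType} (L Cpar Cperp Ctau : R) (u1 u2 : R -> R).
Local Notation mu := (@lebesgue_measure R).

Definition body_twist (th : R -> R) (ph : R -> torus R) (t : R) : 'cV[R]_(3 + 3) :=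
  u1 t *: of_torus (v1 L Cpar Cperp Ctau (th t)) (ph t) +
  u2 t *: of_torus (v2 L Cpar Cperp Ctau (th t)) (ph t).

Lemma swimmer_solution_derive x Q th ph :
  swimmer_solution L Cpar Cperp Ctau u1 u2 x Q th ph ->
  [/\ {ae mu, forall t : R, 0 < t -> is_derive t 1 th (u2 t)},
      {ae mu, forall t : R, 0 < t ->
        is_derive t 1 x (Q t *m usubmx (body_twist th ph t))} &
      {ae mu, forall t : R, 0 < t ->
        is_derive t 1 Q (Q t *m Defs.skew (dsubmx (body_twist th ph t)))}].
Proof.
move=> [_ _ _ rQ [psi [_ _ sol]]]; split; apply: ae_sub sol => t + t0;
  move=> /(_ t0)[_ dth dx dQ [w [Dw E]]] //; have rQt := rQ _ (ltW t0).
- split => //; rewrite -derive1E /body_twist -E col_mxKu mulmxA mulmxV ?mul1mx//.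
  by case: (rotation_tr _ rQt).
- split => //; rewrite -derive1E; apply/angular_velocityP => //.
  by exists w; rewrite /body_twist -E col_mxKd.
Qed.

Lemma cauchy_solution_unique x0 Q0 th0 ph0 x Q x' Q' : is_rotation Q0 ->
  cauchy_solution L Cpar Cperp Ctau u1 u2 x0 Q0 th0 ph0 x Q ->
  cauchy_solution L Cpar Cperp Ctau u1 u2 x0 Q0 th0 ph0 x' Q' ->
  forall t, 0 <= t -> x' t = x t /\ Q' t = Q t.
Proof.
move=> rQ0 [[x_0 Q_0] [th [ph [[th_0 ph_0] sol]]]].
move=> [[x'_0 Q'_0] [th' [ph' [[th'_0 ph'_0] sol']]]].
have [dth dx dQ] := swimmer_solution_derive _ _ _ _ sol.
have [dth' dx' dQ'] := swimmer_solution_derive _ _ _ _ sol'.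
have [xAC QAC thAC rQ [psi [lpsi psiAC aesol]]] := sol.
have [x'AC Q'AC th'AC rQ' [psi' [lpsi' psi'AC aesol']]] := sol'.
have thE t : 0 <= t -> th' t = th t.
  by apply: abs_cont0y_derive_eq dth' dth _ _ => //; rewrite th'_0.
(* The lifts start at values that agree modulo 2 pi and have the same derivative [u1], so the
   initial multiple of 2 pi separates them at all times. *)
have phE t : 0 <= t -> ph' t = ph t.
  move=> t0; have : ph' 0 = ph 0 by rewrite ph'_0.
  rewrite (lpsi' _ (lexx 0)) (lpsi _ (lexx 0)) (lpsi' _ t0) (lpsi _ t0).
  move=> /to_torus_eq[k psi0]; apply/to_torus_eq; exists k.
  apply: (@abs_cont0y_derive_eq _ _ psi' (fun s => psi s + (pi *+ 2) *~ k) u1) => //.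
  - move=> T T0; apply: (@abs_cont_le2 _ _ _ _ _ _ 1 psi psi); try exact: psiAC.
    by move=> s r _ _ _; rewrite mul1r opprD addrACA subrr addr0 lerDl.
  - by apply: ae_sub aesol' => s + s0 => /(_ s0)[].
  - apply: ae_sub aesol => s + s0 => /(_ s0)[dpsi _ _ _ _].
    rewrite (_ : (fun _ => _) = psi + cst ((pi *+ 2) *~ k)); last exact/funext.
    by apply: is_derive_eq; rewrite addr0.
have twE t : 0 <= t -> body_twist th' ph' t = body_twist th ph t.
  by move=> t0; rewrite /body_twist thE// phE.
(* Since the twists coincide, both rotations follow the same skew flow, so [Q' Q^T] keeps its
   initial value 1; orthogonality of [Q] then gives equality. *)
have QE t : 0 <= t -> Q' t = Q t.
  move=> t0.
  have := @skew_flow_orthogonal _ _ Q' Q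
    (fun s => Defs.skew (dsubmx (body_twist th ph s))) Q'AC QAC.
  have := rotation_tr _ rQ0 => -[_ _ Q00].
  rewrite Q'_0 Q_0 Q00 => /(_ _ _ dQ _ t0) QQ1.
  have {}QQ1 : Q' t *m (Q t)^T = 1%:M.
    apply: QQ1; first by move=> s; exact: tr_skew.
    by apply: ae_sub dQ' => s + s0 => /(_ s0); rewrite twE// ltW.
  have [QQ _] := rQ _ t0.
  by rewrite -[LHS]mulmx1 -QQ mulmxA QQ1 mul1mx.
move=> t t0; split; last exact: QE.
apply: abs_cont0y_derive_eq dx _ t t0 => //; last by rewrite x'_0.
by apply: ae_sub dx' => s + s0 => /(_ s0); rewrite QE ?twE// ltW.
Qed.

End solutions.

(** * Existence for the swimmer *)

Section existence.
Context {R : realType}.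
Local Notation mu := (@lebesgue_measure R).

(** Orthogonality makes the squared determinant 1; a change of sign would, by the intermediate value
    theorem, force a zero in between. *)
Lemma det_constant (Q : R -> 'M[R]_3) : mx_continuous 3 3 Q -> \det (Q 0) = 1 ->
  (forall t, 0 <= t -> (Q t)^T *m Q t = 1%:M) -> forall t, 0 <= t -> \det (Q t) = 1.
Proof.
move=> cQ dQ0 QQ t t0.
have d2 s : 0 <= s -> \det (Q s) ^+ 2 = 1.
  by move=> s0; rewrite expr2 -[X in X * _]det_tr -det_mulmx QQ// det1.
have /eqP := d2 t t0; rewrite sqrf_eq1 => /orP[/eqP//|/eqP dQt].
have [|c /= c0t dc] := @IVT R (fun s => \det (Q s)) 0 t 0 t0
    (continuous_subspaceT (continuous_det _ _ cQ)).
  by rewrite dQ0 dQt ge_min le_max lerN10 ler01 orbT.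
have := d2 c; rewrite dc expr0n/=.
by move: c0t; rewrite in_itv/= => /andP[-> _] /(_ isT)/esym/eqP; rewrite oner_eq0.
Qed.

Lemma loc_bounded_meas_skew (a : R -> 'cV[R]_3) :
  (forall i j, loc_bounded_meas (fun t => a t i j)) ->
  forall i j, loc_bounded_meas (fun t => Defs.skew (a t) i j).
Proof.
move=> ba.
have bN k : loc_bounded_meas (fun t => - a t k 0).
  rewrite (_ : (fun _ => _) = fun t => -1 * a t k 0).
    by apply: loc_bounded_measM => //; apply: loc_bounded_meas_continuous => t; exact: cvg_cst.
  by apply/funext => t; rewrite mulN1r.
have b0 : loc_bounded_meas (fun _ : R => 0 : R).
  by apply: loc_bounded_meas_continuous => t; exact: cvg_cst.
by apply: ord3_ind; apply: ord3_ind; under eq_fun do rewrite skew_mx mxE /=.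
Qed.

Context (L Cpar Cperp Ctau : R).
Hypotheses (L_gt0 : 0 < L) (Cpar_gt0 : 0 < Cpar) (Cperp_gt0 : 0 < Cperp)
  (Ctau_gt0 : 0 < Ctau).

Lemma cauchy_solution_exists (x0 : 'cV[R]_3) (Q0 : 'M[R]_3) (th0 : R)
    (ph0 : torus R) (u1 u2 : R -> R) :
  is_rotation Q0 -> Linfty0y u1 -> Linfty0y u2 ->
  exists x Q, cauchy_solution L Cpar Cperp Ctau u1 u2 x0 Q0 th0 ph0 x Q.
Proof.
move=> [QQ0 dQ0] /Linfty0y_bounded[w1 bw1 wu1] /Linfty0y_bounded[w2 bw2 wu2].
(* Any real representative of the initial angle can start the lift. *)
pose psi0 : R := repr (ph0 : {eq_quot eqmod2pi_equiv}%qT).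
pose psi t := psi0 + primitive w1 t.
pose th t := th0 + primitive w2 t.
have cpsi : continuous psi.
  by move=> t; apply: cvgD; [exact: cvg_cst|exact: primitive_continuous].
have cth : continuous th.
  by move=> t; apply: cvgD; [exact: cvg_cst|exact: primitive_continuous].
have prim_AC (c : R) (w : R -> R) : loc_bounded_meas w ->
    abs_cont0y (fun t => c + primitive w t : R).
  move=> bw T T0; have pAC := primitive_abs_cont _ bw _ T0.
  apply: (@abs_cont_le2 _ _ _ _ _ _ 1 _ _ _ _ pAC pAC) => s t _ _ _.
  by rewrite mul1r opprD addrACA subrr add0r lerDl.
have prim_derive (c : R) (w : R -> R) (t : R) : is_derive t 1 (primitive w) (w t) ->
    is_derive t 1 (fun s => c + primitive w s : R) (w t).
  move=> dw; rewrite (_ : (fun _ => _) = cst c + primitive w).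
    by apply: is_derive_eq; rewrite add0r.
  exact/funext.
(* The twist is formed with the truncated controls and the real lift, hence is locally bounded
   everywhere; it matches the prescribed twist almost everywhere on ]0, +oo[. *)
pose F t : 'cV[R]_(3 + 3) := w1 t *: v1 L Cpar Cperp Ctau (th t) (psi t) +
                             w2 t *: v2 L Cpar Cperp Ctau (th t) (psi t).
have bF i j : loc_bounded_meas (fun t => F t i j).
  rewrite (_ : (fun _ => _) = fun t => w1 t * v1 L Cpar Cperp Ctau (th t) (psi t) i j
                                     + w2 t * v2 L Cpar Cperp Ctau (th t) (psi t) i j).
    apply: loc_bounded_measD; apply: loc_bounded_measM => //;
      apply: loc_bounded_meas_continuous.
      exact: v1_continuous.
    exact: v2_continuous.
  by apply/funext => t; rewrite !mxE.
pose S t := Defs.skew (dsubmx (F t)).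
have bS : forall i j, loc_bounded_meas (fun t => S t i j).
  apply: loc_bounded_meas_skew => i j.
  by under eq_fun do rewrite mxE.
have [Q [bQ QE]] := linear_ode_integral Q0 S bS.
have bmul p (A : R -> 'M[R]_3) (B : R -> 'M[R]_(3, p)) :
    (forall i j, loc_bounded_meas (fun t => A t i j)) ->
    (forall i j, loc_bounded_meas (fun t => B t i j)) ->
    forall i j, loc_bounded_meas (fun t => (A t *m B t) i j).
  move=> bA bB i j; under eq_fun do rewrite mxE.
  by apply: loc_bounded_meas_sum => k; exact: loc_bounded_measM.
have bQS := bmul _ _ _ bQ bS.
have bQF : forall i j, loc_bounded_meas (fun t => (Q t *m usubmx (F t)) i j).
  by apply: bmul => // i j; under eq_fun do rewrite mxE.
pose x t : 'cV[R]_3 :=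
  \matrix_(i, j) (x0 i j + primitive (fun s => (Q s *m usubmx (F s)) i j) t).
have xE t i j : x t i j = x0 i j + primitive (fun s => (Q s *m usubmx (F s)) i j) t.
  by rewrite mxE.
have Q_0 := mx_primitive0 _ _ _ _ _ QE.
have QAC := mx_primitive_abs_cont _ _ _ _ _ bQS QE.
have dQ := mx_primitive_is_derive _ _ _ _ _ bQS QE.
have dx := mx_primitive_is_derive _ _ _ _ _ bQF xE.
have QQ t : 0 <= t -> (Q t)^T *m Q t = 1%:M.
  (* The flow preserves [Q Q^T], whereas [is_rotation] asks for [Q^T Q]; for square matrices one
     being 1 gives the other. *)
  move=> t0; apply: mulmx1C.
  rewrite (skew_flow_orthogonal _ _ _ S QAC QAC _ dQ dQ t t0).
    by rewrite Q_0 (mulmx1C QQ0).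
  by move=> s; exact: tr_skew.
have rQ t : 0 <= t -> is_rotation (Q t).
  move=> t0; split; first exact: QQ.
  apply: det_constant QQ _ t0; last by rewrite Q_0.
  exact: (mx_primitive_continuous _ _ _ _ _ bQS QE).
exists x, Q; split.
  by split; [exact: mx_primitive0 xE|].
exists th, (fun t => to_torus (psi t)); split.
  split; first by rewrite /th primitive0 addr0.
  by rewrite /psi primitive0 addr0; exact: reprK.
split => //.
- exact: mx_primitive_abs_cont bQF xE.
- exact: prim_AC.
exists psi; split => //; first exact: prim_AC.
have dw1 := primitive_is_derive _ bw1.
have dw2 := primitive_is_derive _ bw2.
apply: ae_sub (ae_and _ _ (ae_and _ _ (ae_and _ _ wu1 wu2) (ae_and _ _ dw1 dw2))
  (ae_and _ _ dx dQ)).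
move=> t [[[wu1t wu2t] [dw1t dw2t]] [dxt dQt]] t0.
have rQt := rQ _ (ltW t0); have [uQ _ _] := rotation_tr _ rQt.
have [derx Dx] := dxt t0; have [derQ DQ] := dQt t0.
rewrite -wu1t// -wu2t//; split => //.
- exact: prim_derive (dw1t t0).
- exact: prim_derive (dw2t t0).
have [w [Dw wF]] := proj2 (angular_velocityP (Q t) _ (dsubmx (F t)) rQt) DQ.
exists w; split; first by move=> v; rewrite derive1E.
rewrite wF derive1E Dx mulmxA mulVmx// mul1mx vsubmxK.
(* By 2 pi-periodicity in the angle, the representative chosen by [of_torus] gives the same values
   as the lift [psi]. *)
rewrite !of_torusE//; [exact: v2_periodic|exact: v1_periodic].
Qed.

End existence.

Theorem theorem2p1 (R : realType) (L Cpar Cperp Ctau : R)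
  (L_gt0 : 0 < L) (Cpar_gt0 : 0 < Cpar) (Cpar_lt : Cpar < Cperp)
  (Ctau_gt0 : 0 < Ctau)
  (x0 : 'cV[R]_3) (Q0 : 'M[R]_3) (Q0_rot : is_rotation Q0)
  (th0 : R) (ph0 : torus R)
  (u1 u2 : R -> R) (u1_Linfty : Linfty0y u1) (u2_Linfty : Linfty0y u2) :
  exists (x : R -> 'cV[R]_3) (Q : R -> 'M[R]_3),
    cauchy_solution L Cpar Cperp Ctau u1 u2 x0 Q0 th0 ph0 x Q /\
    forall (x' : R -> 'cV[R]_3) (Q' : R -> 'M[R]_3),
      cauchy_solution L Cpar Cperp Ctau u1 u2 x0 Q0 th0 ph0 x' Q' ->
      forall t, 0 <= t -> x' t = x t /\ Q' t = Q t.
Proof.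
have Cperp_gt0 := lt_trans Cpar_gt0 Cpar_lt.
have [x [Q sol]] := cauchy_solution_exists L Cpar Cperp Ctau L_gt0 Cpar_gt0
  Cperp_gt0 Ctau_gt0 x0 Q0 th0 ph0 u1 u2 Q0_rot u1_Linfty u2_Linfty.
exists x, Q; split => // x' Q' sol'.
exact: cauchy_solution_unique Q0_rot sol sol'.
Qed.
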